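(* Consider the distributed algorithm described in the context. Assume: (1) (Bounded information) There is a constant $B>0$ such that $\max_{i}\max_{\theta',\theta''\in\Theta}\max_{x\in\mathbb{R}}\sup_{y}\left|\log\frac{f_i(y|x,\theta')}{f_i(y|x,\theta'')}\right|<B$, and for each $i\in\mathcal N$ and $\theta\in\Theta$, $f_i(y|x,\theta)$ is continuous in $x$. (2) (Network) The graph $\mathcal G$ is static, undirected and connected, $W$ is nonnegative and doubly stochastic ($W\boldsymbol 1=\boldsymbol 1$, $\boldsymbol 1^TW=\boldsymbol 1^T$), and the spectral radius $\rho_w$ of $W-\frac{\boldsymbol 1\boldsymbol 1^T}{N}$ lies in $[0,1)$. (3) (Stepsize) $0<\alpha^{(t)}<1$ for all $t$, $\sum_{t=0}^\infty\alpha^{(t)}=\infty$, $\sum_{t=0}^\infty(\alpha^{(t)})^2<\infty$, and $\alpha^{(t)}=\mathcal O(1/t)$. (4) (Costs) There are $\mu,L>0$ such that for every $i\in\mathcal N$, $\theta\in\Theta$ and $x,x'\in\mathbb{R}$: $(\nabla_xJ_i(x',\theta)-\nabla_xJ_i(x,\theta))(x'-x)\ge\mu\|x'-x\|^2$ and $\|\nabla_xJ_i(x',\theta)-\nabla_xJ_i(x,\theta)\|\le L\|x'-x\|$. (5) (Identifiability) For every $\theta\in\Theta$ with $\theta\ne\theta_*$ there is at least one agent $i\in\mathcal N$ with $D_{KL}(f_i(\cdot|x,\theta_* )\,\|\,f_i(\cdot|x,\theta))>0$ for all $x\in\mathbb{R}$. Then for every agent $i\in\mathcal N$, $$\lim_{t\to\infty}x_i^{(t)}=x_*\quad\text{almost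 surely},$$ where $x_*=\arg\min_{x\in\mathbb{R}}\frac1N\sum_{i=1}^NJ_i(x,\theta_* )$.
   Context: Agents: $\mathcal N=\{1,\dots,N\}$. Parameter set: $\Theta=\{\theta_1,\dots,\theta_M\}$, finite; $\theta_*\in\Theta$ is the (unknown) true parameter. Agent $i$ has a cost $J_i(x,\theta)$, $x\in\mathbb{R}$, differentiable in $x$. For decision $x$ and parameter $\theta$, $f_i(\cdot|x,\theta)$ is the probability density (likelihood) of agent $i$'s noisy observation $y_i=J_i(x,\theta)+\epsilon_i$, where $\epsilon_i$ is random noise. Network: graph $\mathcal G$ on $\mathcal N$ with neighbour sets $\mathcal N_i$ and weight matrix $W=[w_{ij}]_{N\times N}$, $w_{ij}>0$ if $j\in\mathcal N_i$ and $w_{ij}=0$ otherwise. $\boldsymbol 1$ is the all-ones vector. Algorithm, with stepsizes $\alpha^{(t)}$: initial decisions $x_i^{(0)}\in\mathbb{R}$ are given, $y_i^{(0)}$ is observed at $x_i^{(0)}$, and $q_i^{(0)}(\theta_m)=1/M$ for all $i,m$. For $t=0,1,2,\dots$ and each $i\in\mathcal N$: $$b_i^{(t)}(\theta_m)=\frac{f_i(y_i^{(t)}|x_i^{(t)},\theta_m)^{\alpha^{(t)}}q_i^{(t)}(\theta_m)}{\sum_{\theta\in\Theta}f_i(y_i^{(t)}|x_i^{(t)},\theta)^{\alpha^{(t)}}q_i^{(t)}(\theta)},\qquad q_i^{(t+1)}(\theta_m)=\frac{\exp\left(\sum_{j=1}^Nw_{ij}\log b_j^{(t)}(\theta_m)\right)}{\sum_{\theta\in\Theta}\exp\left(\sum_{j=1}^Nw_{ij}\log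 b_j^{(t)}(\theta)\right)},$$ $$x_i^{(t+1)}=\sum_{j=1}^Nw_{ij}\Big[x_j^{(t)}-\alpha^{(t)}\sum_{\theta\in\Theta}q_j^{(t+1)}(\theta)\nabla_xJ_j(x_j^{(t)},\theta)\Big],$$ and then the new data $y_i^{(t+1)}=J_i(x_i^{(t+1)},\theta_* )+\epsilon_i$ is observed with fresh noise; i.e. conditionally on the past (all $(x_j^{(s)},y_j^{(s)})$, $s<t$, $j\in\mathcal N$, which determine $x_i^{(t)}$), $y_i^{(t)}$ has density $f_i(\cdot|x_i^{(t)},\theta_* )$. $D_{KL}(f\|g)=\int f(y)\log\frac{f(y)}{g(y)}\,dy$ is the Kullback-Leibler divergence. $\alpha^{(t)}=\mathcal O(1/t)$ means there is a constant $C$ with $\alpha^{(t)}\le C/t$ for all $t\ge1$. *)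

(* Defs.v *)
From HB Require Import structures.
From mathcomp Require Import all_boot all_order all_algebra.
From mathcomp Require Import complex.
From mathcomp Require Import all_classical all_reals all_analysis.

Set Implicit Arguments.
Unset Strict Implicit.
Unset Printing Implicit Defensive.

Import Order.TTheory GRing.Theory Num.Theory.
Import numFieldNormedType.Exports.

Local Open Scope classical_set_scope.
Local Open Scope ring_scope.

Definition is_density (R : realType) (g : R -> R) : Prop :=
  [/\ measurable_fun setT g,
      forall y, 0 <= g y &
      (\int[lebesgue_measure]_y (g y)%:E)%E = 1%E].

(* The logarithm and the quotient are the extended-real ones, for which
   a / 0 = +oo when a > 0, 0 / 0 = 0, ln 0 = -oo and ln +oo = +oo. *)
Definition log_ratio (R : realType) (a b : R) : \bar R :=
  lne (a%:E / b%:E)%E.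

(* With 0 * (-oo) = 0 the integrand follows the usual conventions
   0 * log (0 / b) = 0 for all b >= 0, and a * log (a / 0) = +oo for a > 0. *)
Definition kl_div (R : realType) (f g : R -> R) : \bar R :=
  (\int[lebesgue_measure]_y ((f y)%:E * log_ratio (f y) (g y)))%E.

(* Likelihoods are written [f i y x th] for f_i(y | x, th).  Points y at which
   both densities vanish do not enter the supremum; at a point where exactly one
   of them vanishes the log-ratio is infinite, so the bound forces, for each
   agent and decision, a support common to all the parameters. *)
Definition bounded_information (R : realType) (N : nat) (Theta : finType)
    (f : 'I_N -> R -> R -> Theta -> R) (B : R) : Prop :=
  (ereal_sup [set z : \bar R | exists i th1 th2 x y,
     (f i y x th1 != 0%R \/ f i y x th2 != 0%R) /\
     z = `| log_ratio (f i y x th1) (f i y x th2) | ] < B%:E)%E.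

Definition weights_on_graph (R : realType) (N : nat) (nbr : rel 'I_N)
    (W : 'M[R]_N) : Prop :=
  forall i j, (nbr i j -> 0 < W i j) /\ (~~ nbr i j -> W i j = 0).

Definition doubly_stochastic (R : realType) (N : nat) (W : 'M[R]_N) : Prop :=
  [/\ forall i j, 0 <= W i j,
      W *m const_mx 1 = const_mx 1 :> 'cV[R]_N &
      const_mx 1 *m W = const_mx 1 :> 'rV[R]_N].

(* Largest modulus of a complex eigenvalue; a real matrix need not have any
   real one. *)
Definition spectral_radius (R : realType) (N : nat) (A : 'M[R]_N) : R :=
  sup [set r | exists2 l : R[i],
    eigenvalue (map_mx (real_complex R) A) l & r = ComplexField.Normc.normc l].

(* Gradient in x of the cost J(x, th). *)
Definition grad (R : realType) (Theta : finType) (J : R -> Theta -> R)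
    (x : R) (th : Theta) : R :=
  derive1 (fun z : R => J z th) x.

Definition argmin (R : realType) (F : R -> R) : set R :=
  [set z | forall x, F z <= F x].

Definition bayes_update (R : realType) (Theta : finType)
    (lik : Theta -> R) (a : R) (q : Theta -> R) (th : Theta) : R :=
  (lik th `^ a * q th) / \sum_(th' : Theta) (lik th' `^ a * q th').

Definition log_pooling (R : realType) (N : nat) (Theta : finType)
    (w : 'I_N -> R) (b : 'I_N -> Theta -> R) (th : Theta) : R :=
  expR (\sum_(j < N) w j * ln (b j th)) /
    \sum_(th' : Theta) expR (\sum_(j < N) w j * ln (b j th')).

(* One realization of the algorithm: the trajectories x, y, b and q produced by
   the initial decisions x0 and the noise values eps. *)
Record algorithm_run (R : realType) (N : nat) (Theta : finType)
    (J : 'I_N -> R -> Theta -> R) (f : 'I_N -> R -> R -> Theta -> R)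
    (ths : Theta) (W : 'M[R]_N) (alpha : nat -> R)
    (x0 : 'I_N -> R) (eps : 'I_N -> nat -> R)
    (x y : 'I_N -> nat -> R) (b q : 'I_N -> nat -> Theta -> R) : Prop := {
  run_x0 : forall i, x i 0%N = x0 i ;
  run_q0 : forall i th, q i 0%N th = #|Theta|%:R^-1 ;
  run_y : forall i t, y i t = J i (x i t) ths + eps i t ;
  run_b : forall i t th,
    b i t th = bayes_update (f i (y i t) (x i t)) (alpha t) (q i t) th ;
  run_q : forall i t th,
    q i t.+1 th = log_pooling (W i) (fun j => b j t) th ;
  run_x : forall i t,
    x i t.+1 = \sum_(j < N) W i j *
      (x j t - alpha t * \sum_(th : Theta) q j t.+1 th * grad (J j) (x j t) th)
}.

(* Sigma-algebra generated by all decisions and observations before time t. *)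
Definition past (R : realType) (T : Type) (N : nat)
    (x y : 'I_N -> nat -> T -> R) (t : nat) : set (set T) :=
  <<s [set E | exists j s U, [/\ (s < t)%N, measurable U &
         E = x j s @^-1` U \/ E = y j s @^-1` U] ] >>.

(* Given the sigma-algebra G, the law of Y has Lebesgue density g(w, .). *)
Definition conditional_density (d : measure_display) (T : measurableType d)
    (R : realType) (P : probability T R) (G : set (set T))
    (Y : T -> R) (g : T -> R -> R) : Prop :=
  forall (E : set T) (A : set R), G E -> measurable A ->
    P (E `&` Y @^-1` A) =
    (\int[P]_(w in E) \int[lebesgue_measure]_(v in A) (g w v)%:E)%E.

(* Main.v *)
(** Let l_i^t be the log-likelihood ratio of th against ths at agent i's t-th
    observation.  Wherever the likelihoods are positive, the log-beliefs
    lambda_i = ln q_i(th) - ln q_i(ths) satisfy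
    lambda^{t+1} = W (lambda^t + alpha_t l^t), so they stay close to their mean
    1/N sum_{s<t} alpha_s sum_i l_i^s, because W contracts zero-sum vectors.
    Let Z_t be the exponential of half that mean.  As exp is convex and
    alpha_t < 1, the conditional expectation of Z_{t+1} is at most
    (1 - C alpha_t) Z_t, where C > 0 comes from the squared Hellinger distance
    int (sqrt f(ths) - sqrt f(th))^2: it is positive wherever the Kullback-Leibler
    divergence is, and lower semicontinuous in x by Fatou, hence bounded below
    on the compact interval that contains all the iterates.  Thus E Z_t -> 0, and
    the maximal inequality for nonnegative supermartingales gives Z_t -> 0
    almost surely.  All beliefs then concentrate on ths, and the mean decision
    follows a gradient descent on the strongly convex average cost, perturbed
    by a vanishing error. *)

Require Import Defs.
From HB Require Import structures.
From mathcomp Require Import all_boot all_order all_algebra.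
From mathcomp Require Import complex.
From mathcomp Require Import all_classical all_reals all_analysis.
From mathcomp Require Import measurable_realfun ring lra.

Set Implicit Arguments.
Unset Strict Implicit.
Unset Printing Implicit Defensive.

Import Order.TTheory GRing.Theory Num.Theory.
Import numFieldNormedType.Exports.

Local Open Scope classical_set_scope.
Local Open Scope ring_scope.

(** * Recursive inequalities *)

(** The laws of the observations move with the decisions, which depend on past data, and
    identifiability is pointwise in [x], without a uniform gap. The iterates are therefore confined
    by one constant valid for every realization, before any probability enters; this is possible
    because every belief-weighted gradient inherits [mu] and [L]. The exponent one half produces the
    decay: the likelihood ratio itself has conditional expectation 1, whereas its square root has
    the Hellinger affinity, smaller than 1 when the densities differ. The Hellinger integrand is
    also nonnegative, so Fatou's lemma applies directly, unlike for the signed integrand of the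
    Kullback-Leibler divergence. Finally, only each agent's own conditional law is given, so the
    expectation of a product of ratios over agents is out of reach; convexity replaces the product
    by a mean, and one informative agent then yields decay at rate [c / (2 N)], which the divergence
    of the stepsize sum turns into convergence. *)

Lemma contraction_cvg0 (R : realType) (c : R) (a e u : nat -> R) :
  0 < c -> (forall t, 0 <= a t) ->
  (\forall t \near \oo, c * a t <= 1) ->
  (forall M, \forall n \near \oo, M <= \sum_(0 <= s < n) a s) ->
  e t @[t --> \oo] --> 0 -> (forall t, 0 <= u t) ->
  (\forall t \near \oo, u t.+1 <= (1 - c * a t) * u t + a t * e t) ->
  u t @[t --> \oo] --> 0.
Proof.
move=> c0 a0 ca1 adiv e0 u0 urec.
apply/cvgrPdist_lt => eps eps0.
pose d := eps / 2; have d0 : 0 < d by rewrite divr_gt0.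
have ecd : \forall t \near \oo, e t <= c * d.
  move/cvgrPdist_le : e0 => /(_ (c * d) (mulr_gt0 c0 d0)).
  by apply: filterS => t; rewrite sub0r normrN; apply: le_trans; exact: ler_norm.
have [T _ HT] : \forall t \near \oo,
    [/\ c * a t <= 1, e t <= c * d & u t.+1 <= (1 - c * a t) * u t + a t * e t].
  by near do split.
(* Once [e t <= c * d], the excess [u t - d] is multiplied at each step by at most [1 - c * a t],
   itself at most [expR (- (c * a t))]; the partial sums of [a] thus govern the decay. *)
pose A n := \sum_(T <= s < T + n) a s.
have bnd n : u (T + n)%N - d <= expR (- (c * A n)) * u T.
  elim: n => [|n IH].
    by rewrite addn0 /A addn0 big_geq// mulr0 oppr0 expR0 mul1r gerBl ltW.
  have [ca ec ur] := HT (T + n)%N (leq_addr _ _).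
  have -> : A n.+1 = A n + a (T + n)%N.
    by rewrite /A addnS big_nat_recr//= leq_addr.
  rewrite addnS mulrDr opprD expRD.
  have h1 : u (T + n).+1 - d <= (1 - c * a (T + n)%N) * (u (T + n)%N - d).
    have := ler_wpM2l (a0 (T + n)%N) ec; lra.
  apply: (le_trans h1).
  have ca' : 0 <= 1 - c * a (T + n)%N by rewrite subr_ge0.
  apply: (le_trans (ler_wpM2l ca' IH)).
  rewrite mulrA ler_wpM2r// mulrC ler_wpM2l ?expR_ge0//.
  exact: expR_ge1Dx.
(* Beyond this threshold [c * A] is at least [u T / d], and [expR (c * A) >= 1 + c * A] brings the
   decayed term below [d], the other half of [eps]. *)
pose M := \sum_(0 <= s < T) a s + u T / d / c.
have [T' _ HT'] := adiv M.
exists (maxn T T') => // n /=; rewrite geq_max => /andP[Tn T'n].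
rewrite sub0r normrN ger0_norm//.
have := bnd (n - T)%N; rewrite subnKC// => bn.
have AM : u T / d <= c * A (n - T)%N.
  have := HT' n T'n; rewrite /M /A subnKC// (big_cat_nat (leq0n T) Tn) lerD2l.
  by rewrite ler_pdivrMr// [X in _ <= X -> _]mulrC.
have : expR (- (c * A (n - T)%N)) * u T < d.
  rewrite expRN mulrC ltr_pdivrMr ?expR_gt0// mulrC -ltr_pdivrMr//.
  apply: lt_le_trans (expR_ge1Dx _).
  by rewrite (le_lt_trans AM)// ltrDr.
by rewrite /d in bn *; lra.
Unshelve. all: by end_near. Qed.

Lemma nneseries_pinfty_sum_ge (R : realType) (a : nat -> R) :
  (forall t, 0 <= a t) -> (\sum_(0 <= t <oo) (a t)%:E = +oo)%E ->
  forall M, \forall n \near \oo, M <= \sum_(0 <= s < n) a s.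
Proof.
move=> a0 ainf M.
have cv : (\sum_(0 <= t < n) (a t)%:E)%E @[n --> \oo] --> +oo%E.
  rewrite -ainf; apply: is_cvg_nneseries => n _ _.
  by rewrite lee_fin.
have /cvgeyPge/(_ M) := cv.
by apply: filterS => n; rewrite sumEFin lee_fin.
Qed.

Lemma cvg0_harmonic_bound (R : realType) (a : nat -> R) (C : R) :
  (forall t, 0 <= a t) -> (forall t, (1 <= t)%N -> a t <= C / t%:R) ->
  a t @[t --> \oo] --> 0.
Proof.
move=> a0 aC; apply/cvgrPdist_le => eps eps0.
near=> t; rewrite sub0r normrN ger0_norm//.
have t0 : (1 <= t)%N by near: t; exists 1%N.
apply: (le_trans (aC t t0)); rewrite ler_pdivrMr ?ltr0n// -ler_pdivrMl//.
by near: t; exact: nbhs_infty_ger.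
Unshelve. all: by end_near. Qed.

(** * Consensus *)

(** A real [sup] bounds its set only if the set is bounded above; the eigenvalues are roots of the
    characteristic polynomial, and the sum of the moduli of these roots is an upper bound. *)
Lemma eigenvalue_le_spectral_radius (R : realType) (N : nat) (A : 'M[R]_N)
    (l : R[i]) :
  eigenvalue (map_mx (real_complex R) A) l ->
  ComplexField.Normc.normc l <= spectral_radius A.
Proof.
move=> Al; apply: ub_le_sup; last by exists l.
have [s ps] := closed_field_poly_normal (char_poly (map_mx (real_complex R) A)).
have := char_poly_monic (map_mx (real_complex R) A).
move/monicP => lc1; rewrite lc1 scale1r in ps.
exists (\sum_(z <- s) ComplexField.Normc.normc z) => _ [z zA ->].
have zs : z \in s by rewrite eigenvalue_root_char ps root_prod_XsubC in zA.
have normc_ge0 (c : R[i]) : 0 <= ComplexField.Normc.normc c.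
  by case: c => *; exact: sqrtr_ge0.
by rewrite (big_rem z)//= lerDl sumr_ge0.
Qed.

(** The value -1 is an eigenvalue. Since [eigenvalue] speaks of row vectors, the column vector [v]
    is exchanged for a row vector through the vanishing determinant of [A + 1%:M]. *)
Lemma spectral_radius_ge1 (R : realType) (N : nat) (A : 'M[R]_N) (v : 'cV[R]_N) :
  v != 0 -> A *m v = - v -> 1 <= spectral_radius A.
Proof.
move=> v0 Av.
have : \det (A + 1%:M)^T == 0.
  apply/det0P; exists v^T.
    by apply: contra v0 => /eqP v0; rewrite -(trmxK v) v0 trmx0.
  by rewrite -trmx_mul mulmxDl Av mul1mx addNr trmx0.
rewrite det_tr => /det0P[u u0]; rewrite mulmxDr mulmx1 => /eqP.
rewrite addr_eq0 => /eqP uA.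
have /eigenvalue_le_spectral_radius : eigenvalue (map_mx (real_complex R) A) (-1).
  apply/eigenvalueP; exists (map_mx (real_complex R) u).
    by rewrite -map_mxM uA map_mxN scaleN1r.
  by rewrite map_mx_eq0.
by rewrite /ComplexField.Normc.normc /= oppr0 sqrrN expr0n addr0 expr1n sqrtr1.
Qed.

Lemma doubly_stochastic_row (R : realType) (N : nat) (W : 'M[R]_N) (i : 'I_N) :
  doubly_stochastic W -> \sum_j W i j = 1.
Proof.
move=> [_ /matrixP/(_ i ord0) + _]; rewrite !mxE => <-.
by apply: eq_bigr => j _; rewrite mxE mulr1.
Qed.

Lemma doubly_stochastic_col (R : realType) (N : nat) (W : 'M[R]_N) (j : 'I_N) :
  doubly_stochastic W -> \sum_i W i j = 1.
Proof.
move=> [_ _ /matrixP/(_ ord0 j)]; rewrite !mxE => <-.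
by apply: eq_bigr => i _; rewrite mxE mul1r.
Qed.

(** Row sums equal to 1 make each inner sum a variance; column sums equal to 1 make the second
    moments add up to the squared norm of [v]. The norm lost under [W] is thus a sum of nonnegative
    terms, each of which vanishes in case of equality. *)
Lemma weighted_variance (R : realType) (N : nat) (W : 'M[R]_N) (v : 'I_N -> R) :
  doubly_stochastic W ->
  \sum_i \sum_j W i j * (v j - \sum_k W i k * v k) ^+ 2 =
  \sum_j v j ^+ 2 - \sum_i (\sum_j W i j * v j) ^+ 2.
Proof.
move=> Wds.
have row1 i := doubly_stochastic_row i Wds.
have col1 j := doubly_stochastic_col j Wds.
have -> : \sum_j v j ^+ 2 = \sum_i \sum_j W i j * v j ^+ 2.
  by rewrite exchange_big/=; apply: eq_bigr => j _; rewrite -mulr_suml col1 mul1r.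
rewrite -sumrB; apply: eq_bigr => i _.
set u := \sum_k W i k * v k.
transitivity (\sum_j (W i j * v j ^+ 2 - (W i j * v j) * (2 * u) + W i j * u ^+ 2)).
  by apply: eq_bigr => j _; ring.
rewrite big_split/= sumrB -!mulr_suml row1 -/u; ring.
Qed.

Lemma connect_const (T : finType) (U : Type) (e : rel T) (h : T -> U) :
  (forall x y, e x y -> h x = h y) -> forall x y, connect e x y -> h x = h y.
Proof.
move=> eh x y /connectP[p]; elim: p x => [x _ ->//|z p IH x /= /andP[xz zp] yp].
by rewrite (eh _ _ xz); exact: IH.
Qed.

(* If W preserves the norm of a zero-sum v, then v is constant on every
   neighbourhood, so v + W v is constant on the graph and W v = - v. *)
Lemma strict_contraction (R : realType) (N : nat) (nbr : rel 'I_N)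
    (W : 'M[R]_N) (v : 'I_N -> R) :
  symmetric nbr -> (forall i j, connect nbr i j) ->
  weights_on_graph nbr W -> doubly_stochastic W ->
  spectral_radius (W - N%:R^-1 *: const_mx 1) < 1 ->
  \sum_i v i = 0 -> \sum_i v i ^+ 2 != 0 ->
  \sum_i (\sum_j W i j * v j) ^+ 2 < \sum_i v i ^+ 2.
Proof.
move=> nsym ncon Wg Wds rad sv0 nv0.
have [Wge0 _ _] := Wds.
have col1 j := doubly_stochastic_col j Wds.
have nonneg i j : 0 <= W i j * (v j - \sum_k W i k * v k) ^+ 2.
  by rewrite mulr_ge0// sqr_ge0.
rewrite lt_neqAle; apply/andP; split; last first.
  rewrite -subr_ge0 -weighted_variance//.
  by apply: sumr_ge0 => i _; apply: sumr_ge0.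
apply/negP => /eqP e.
have := weighted_variance v Wds; rewrite e subrr => /eqP.
rewrite psumr_eq0; last by move=> i _; apply: sumr_ge0.
move=> /allP z.
have cst i j : nbr i j -> \sum_k W i k * v k = v j.
  move=> ij; have := z i (mem_index_enum _); rewrite implyTb psumr_eq0//.
  move=> /allP/(_ j (mem_index_enum _)); rewrite implyTb mulf_eq0.
  have [/(_ ij)Wij _] := Wg i j.
  by rewrite gt_eqF//= sqrf_eq0 subr_eq0 => /eqP <-.
pose h i := v i + \sum_k W i k * v k.
have hcst i j : h i = h j.
  apply: (connect_const _ (ncon i j)) => {}i {}j ij.
  rewrite /h (cst _ _ ij); rewrite nsym in ij; by rewrite (cst _ _ ij) addrC.
have sh : \sum_i h i = 0.
  rewrite big_split/= sv0 add0r exchange_big/= -[RHS]sv0.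
  by apply: eq_bigr => j _; rewrite -mulr_suml col1 mul1r.
have h0 i : h i = 0.
  move: sh; rewrite (eq_bigr (fun=> h i)); last by move=> j _; exact: hcst.
  rewrite sumr_const card_ord => /eqP; rewrite mulrn_eq0 => /orP[/eqP N0|/eqP//].
  by have := ltn_ord i; rewrite {2}N0.
(* The rank-one term kills the zero-sum [v], so [W v = - v] would give the eigenvalue -1: the radius
   bound excludes this oscillation. *)
have : 1 <= spectral_radius (W - N%:R^-1 *: const_mx 1).
  apply: (@spectral_radius_ge1 _ _ _ (\col_i v i)).
    apply: contra nv0 => /eqP/matrixP v0; apply/eqP/big1 => i _.
    by have := v0 i ord0; rewrite !mxE => ->; rewrite expr0n.
  apply/matrixP => i k; rewrite mulmxBl -scalemxAl !mxE.
  under eq_bigr do rewrite mxE.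
  under [X in _ - _ * X]eq_bigr do rewrite !mxE mul1r.
  rewrite sv0 mulr0 subr0; have := h0 i; rewrite /h => /eqP.
  by rewrite addrC addr_eq0 => /eqP.
by rewrite leNgt rad.
Qed.

Lemma continuous_sum (R : realType) (I : finType) (U : topologicalType)
    (F : I -> U -> R) :
  (forall i, continuous (F i)) -> continuous (fun x => \sum_i F i x).
Proof.
move=> cF; apply: continuous_big => // x; exact: add_continuous.
Qed.

(** [W] need not be symmetric, so its spectral radius does not directly control the Euclidean norm.
    The uniform factor comes from compactness: the strict inequality is maximized over the unit
    sphere of the zero-sum vectors. *)
Lemma consensus_contraction (R : realType) (N : nat) (nbr : rel 'I_N)
    (W : 'M[R]_N) :
  symmetric nbr -> (forall i j, connect nbr i j) ->
  weights_on_graph nbr W -> doubly_stochastic W ->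
  spectral_radius (W - N%:R^-1 *: const_mx 1) < 1 ->
  exists2 r : R, 0 < r < 1 & forall v : 'I_N -> R, \sum_i v i = 0 ->
    \sum_i (\sum_j W i j * v j) ^+ 2 <= r * \sum_i v i ^+ 2.
Proof.
move=> nsym ncon Wg Wds rad.
have contr (v : 'I_N -> R) := @strict_contraction _ _ _ _ v nsym ncon Wg Wds rad.
pose F (v : 'rV[R]_N) := \sum_i (\sum_j W i j * v ord0 j) ^+ 2.
pose Q (v : 'rV[R]_N) := \sum_i v ord0 i ^+ 2.
pose S := [set v : 'rV[R]_N | \sum_i v ord0 i = 0 /\ Q v = 1].
have cc j : continuous (fun v : 'rV[R]_N => v ord0 j) by exact: coord_continuous.
have csqr (g : 'rV[R]_N -> R) : continuous g -> continuous (fun v => g v ^+ 2).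
  move=> cg v; apply: (@continuous_comp _ _ _ g (fun x => x ^+ 2)).
    exact: cg.
  exact: exprn_continuous.
have cQ : continuous Q by apply: continuous_sum => i; apply: csqr.
have cF : continuous F.
  apply: continuous_sum => i; apply: csqr; apply: continuous_sum => j v.
  apply: (@continuousM _ _ (fun=> W i j) (fun v : 'rV[R]_N => v ord0 j) v).
    exact: cst_continuous.
  exact: cc.
have Scl : closed S.
  have -> : S = (fun v : 'rV[R]_N => \sum_i v ord0 i) @^-1` [set 0] `&`
                Q @^-1` [set 1] by [].
  apply: closedI; (apply: preimage_closed; last exact: closed_eq) => v _.
    exact: continuous_sum.
  exact: cQ.
have Sbd : bounded_set S.
  exists 1; split; first exact: num_real.
  move=> M M1 v [_ Qv]; rewrite /Num.Def.normr/= mx_normrE.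
  apply/bigmax_leP; split=> [|[k i] _ /=]; first lra.
  rewrite ord1; apply: le_trans (ltW M1).
  have : v ord0 i ^+ 2 <= 1 ^+ 2.
    by rewrite expr1n -Qv /Q (bigD1 i)//= lerDl sumr_ge0// => j _; exact: sqr_ge0.
  by rewrite -ler_sqrt ?sqr_ge0// !sqrtr_sqr normr1.
have Scomp : compact S by exact: bounded_closed_compact.
(* the bound on the unit sphere extends by homogeneity *)
suff [r r01 Sr] : exists2 r : R, 0 < r < 1 & forall v, S v -> F v <= r.
  exists r => // v sv.
  have [/eqP Q0|Qn0] := boolP (\sum_i v i ^+ 2 == 0).
    have v0 i : v i = 0.
      move/eqP: Q0; rewrite psumr_eq0 => [/allP/(_ i (mem_index_enum _))|*].
        by rewrite implyTb sqrf_eq0 => /eqP.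
      exact: sqr_ge0.
    rewrite Q0 mulr0 big1// => i _; rewrite big1 ?expr0n// => j _.
    by rewrite v0 mulr0.
  set q := \sum_i v i ^+ 2 in Qn0 *.
  have q0 : 0 < q by rewrite lt_def Qn0 sumr_ge0// => *; exact: sqr_ge0.
  pose s := Num.sqrt q; have s0 : 0 < s by rewrite sqrtr_gt0.
  have sq : s ^+ 2 = q by rewrite sqr_sqrtr// ltW.
  have /Sr : S (\row_j (s^-1 * v j)).
    split; first by under eq_bigr do rewrite mxE; rewrite -mulr_sumr sv mulr0.
    rewrite /Q; under eq_bigr do rewrite mxE exprMn.
    by rewrite -mulr_sumr exprVn sq mulVf.
  suff -> : F (\row_j (s^-1 * v j)) = q^-1 * \sum_i (\sum_j W i j * v j) ^+ 2.
    by rewrite ler_pdivrMl// mulrC.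
  rewrite /F mulr_sumr; apply: eq_bigr => i _.
  rewrite -sq -exprVn -exprMn; congr (_ ^+ 2).
  by rewrite mulr_sumr; apply: eq_bigr => j _; rewrite mxE mulrCA.
(* With a single agent the sphere is empty and any factor will do. *)
have [->|S0] := eqVneq S set0; first by exists (1 / 2) => //; lra.
have [c cS Fc] := EVT_max_rV (proj1 (set0P _) S0) Scomp (continuous_subspaceT cF).
have Fc1 : F c < 1.
  rewrite inE in cS; have [sc Qc] := cS.
  by rewrite -Qc; apply: contr => //; rewrite -/(Q c) Qc oner_neq0.
(* The midpoint between the maximum and 1 stays positive even when the maximum is 0. *)
exists ((1 + F c) / 2).
  have : 0 <= F c by apply: sumr_ge0 => *; exact: sqr_ge0.
  by move=> ?; apply/andP; split; lra.
move=> v Sv; apply: (le_trans (Fc v _)); first by rewrite inE.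
lra.
Qed.

Definition mean (R : realType) (N : nat) (u : 'I_N -> R) : R :=
  N%:R^-1 * \sum_i u i.

Lemma meanD (R : realType) (N : nat) (u v : 'I_N -> R) (a : R) :
  mean (fun i => u i + a * v i) = mean u + a * mean v.
Proof. by rewrite /mean big_split/= -mulr_sumr; ring. Qed.

Lemma sum_sub_mean (R : realType) (N : nat) (u : 'I_N -> R) :
  (0 < N)%N -> \sum_i (u i - mean u) = 0.
Proof.
move=> N0; rewrite sumrB sumr_const card_ord /mean -[X in _ - X]mulr_natl mulrA.
by rewrite divff ?mul1r ?subrr// pnatr_eq0 -lt0n.
Qed.

Lemma mean_stochastic (R : realType) (N : nat) (W : 'M[R]_N) (u : 'I_N -> R) :
  doubly_stochastic W -> mean (fun i => \sum_j W i j * u j) = mean u.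
Proof.
move=> Wds; rewrite /mean exchange_big/=; congr (_ * _).
apply: eq_bigr => j _.
by rewrite -mulr_suml doubly_stochastic_col// mul1r.
Qed.

Lemma ler_norm_wavg (R : realType) (I : finType) (p u : I -> R) (C : R) :
  (forall i, 0 <= p i) -> \sum_i p i = 1 -> (forall i, `|u i| <= C) ->
  `|\sum_i p i * u i| <= C.
Proof.
move=> p0 p1 uC; apply: (le_trans (ler_norm_sum _ _ _)).
rewrite -[leRHS]mul1r -p1 mulr_suml; apply: ler_sum => i _.
by rewrite normrM (ger0_norm (p0 i)) ler_wpM2l.
Qed.

Lemma ler_norm_mean (R : realType) (N : nat) (u : 'I_N -> R) (C : R) :
  (0 < N)%N -> (forall i, `|u i| <= C) -> `|mean u| <= C.
Proof.
move=> N0 uC; rewrite /mean mulr_sumr; apply: ler_norm_wavg => //.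
by rewrite sumr_const card_ord -[LHS]mulr_natl divff// pnatr_eq0 -lt0n.
Qed.

(** [W] preserves means, so the deviations from the mean are zero-sum and are driven only by the
    deviations of [a t * g t]. Their squared norm contracts up to a term of order [a t ^+ 2]. Both
    the log-beliefs and the decisions have this form. *)
Lemma consensus_cvg (R : realType) (N : nat) (W : 'M[R]_N) (r C : R)
    (a : nat -> R) (v g : nat -> 'I_N -> R) :
  (0 < N)%N -> doubly_stochastic W -> 0 < r < 1 ->
  (forall v : 'I_N -> R, \sum_i v i = 0 ->
    \sum_i (\sum_j W i j * v j) ^+ 2 <= r * \sum_i v i ^+ 2) ->
  a t @[t --> \oo] --> 0 -> (forall t j, `|g t j| <= C) ->
  (forall t i, v t.+1 i = \sum_j W i j * (v t j + a t * g t j)) ->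
  forall i, v t i - mean (v t) @[t --> \oo] --> 0.
Proof.
move=> N0 Wds /andP[r0 r1] Wr a0 gC vrec i.
pose S t := \sum_i (v t i - mean (v t)) ^+ 2.
have S_ge0 t : 0 <= S t by apply: sumr_ge0 => *; exact: sqr_ge0.
(* Young's inequality with weights [1 + h] and [1 + h^-1] absorbs the cross term; as
   [r = 1 - 2 * h], the product [r * (1 + h)] is still at most [1 - h]. *)
pose h := (1 - r) / 2; have h0 : 0 < h by rewrite /h; lra.
pose K := (1 + h^-1) * (N%:R * (2 * C) ^+ 2).
have SS t : S t.+1 <= (1 - h) * S t + K * a t ^+ 2.
  pose dd j := v t j - mean (v t).
  pose hh j := a t * (g t j - mean (g t)).
  have -> : S t.+1 = \sum_i (\sum_j W i j * (dd j + hh j)) ^+ 2.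
    apply: eq_bigr => k _; congr (_ ^+ 2).
    have -> : mean (v t.+1) = mean (v t) + a t * mean (g t).
      by rewrite (funext (vrec t)) mean_stochastic// meanD.
    rewrite vrec -[X in _ - X]mul1r -(doubly_stochastic_row k Wds) mulr_suml -sumrB.
    by apply: eq_bigr => j _; rewrite /dd /hh; ring.
  apply: le_trans (Wr _ _) _.
    by rewrite big_split/= -mulr_sumr !sum_sub_mean// mulr0 addr0.
  have sq : \sum_j (dd j + hh j) ^+ 2 <=
      (1 + h) * S t + (1 + h^-1) * \sum_j hh j ^+ 2.
    rewrite /S !mulr_sumr -big_split/=; apply: ler_sum => j _.
    rewrite -/(dd j) -subr_ge0.
    rewrite (_ : _ - _ = h^-1 * (h * dd j - hh j) ^+ 2); last first.
      by field; rewrite gt_eqF.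
    by rewrite mulr_ge0 ?sqr_ge0// invr_ge0 ltW.
  have hb : \sum_j hh j ^+ 2 <= N%:R * (2 * C) ^+ 2 * a t ^+ 2.
    have -> : N%:R * (2 * C) ^+ 2 * a t ^+ 2 = \sum_(j < N) (2 * C * a t) ^+ 2.
      by rewrite sumr_const card_ord -[RHS]mulr_natl; ring.
    apply: ler_sum => j _; rewrite /hh -[leLHS]real_normK ?num_real//.
    rewrite -[leRHS]real_normK ?num_real// lerXn2r// ?nnegrE//.
    rewrite !normrM mulrC ler_wpM2r//.
    have C0 : 0 <= C by apply: le_trans (gC 0%N i).
    rewrite -normrM (ger0_norm (mulr_ge0 _ C0))//.
    apply: (le_trans (ler_normB _ _)).
    by have := gC t j; have := ler_norm_mean N0 (gC t); lra.
  have h10 : 0 <= 1 + h^-1 by rewrite addr_ge0// invr_ge0 ltW.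
  have hn : 0 <= \sum_j hh j ^+ 2 by apply: sumr_ge0 => *; exact: sqr_ge0.
  have e1 : r * (1 + h) <= 1 - h by rewrite /h; nra.
  apply: (le_trans (ler_wpM2l (ltW r0) sq)).
  rewrite mulrDr mulrA; apply: lerD; first by rewrite ler_wpM2r.
  apply: (@le_trans _ _ (1 * ((1 + h^-1) * \sum_j hh j ^+ 2))).
    by rewrite ler_wpM2r ?mulr_ge0// ltW.
  by rewrite mul1r /K -mulrA ler_wpM2l.
have S0 : S t @[t --> \oo] --> 0.
  apply: (@contraction_cvg0 _ h (fun=> 1) (fun t => K * a t ^+ 2)) => //.
  - by apply: nearW => t; rewrite mulr1 /h; lra.
  - move=> M; near=> n; rewrite sumr_const_nat subn0.
    by near: n; exact: nbhs_infty_ger.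
  - rewrite (_ : 0 = K * (0 * 0)); last by rewrite !mulr0.
    by apply: cvgMr; under eq_fun do rewrite expr2; exact: cvgM.
  - by apply: nearW => t; rewrite mulr1 mul1r.
apply/cvgrPdist_lt => eps eps0.
move/cvgrPdist_lt : S0 => /(_ _ (exprn_gt0 2 eps0)).
apply: filterS => t; rewrite !sub0r !normrN (ger0_norm (S_ge0 t)) => Se.
rewrite -(@ltr_pXn2r _ 2)// ?nnegrE ?(ltW eps0)// real_normK ?num_real//.
apply: le_lt_trans Se; rewrite /S (bigD1 i)//= lerDl.
by apply: sumr_ge0 => *; exact: sqr_ge0.
Unshelve. all: by end_near. Qed.

(** * Gradient descent on strongly convex costs *)

Definition regular_gradient (R : realType) (mu L : R) (phi : R -> R) : Prop :=
  (forall z z', mu * `|z' - z| ^+ 2 <= (phi z' - phi z) * (z' - z)) /\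
  (forall z z', `|phi z' - phi z| <= L * `|z' - z|).

(** Both conditions survive convex combination with unchanged constants, so they hold for a
    belief-weighted gradient whatever the beliefs are. *)
Lemma regular_gradient_wavg (R : realType) (mu L : R) (I : finType) (p : I -> R)
    (phi : I -> R -> R) :
  (forall i, 0 <= p i) -> \sum_i p i = 1 ->
  (forall i, regular_gradient mu L (phi i)) ->
  regular_gradient mu L (fun z => \sum_i p i * phi i z).
Proof.
move=> p0 p1 rphi.
have diffE z z' : \sum_i p i * phi i z' - \sum_i p i * phi i z =
    \sum_i p i * (phi i z' - phi i z).
  by rewrite -sumrB; apply: eq_bigr => i _; ring.
split=> z z'; rewrite diffE.
  rewrite mulr_suml -[leLHS]mul1r -p1 mulr_suml; apply: ler_sum => i _.
  by rewrite -mulrA ler_wpM2l//; have [h _] := rphi i; exact: h.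
by apply: ler_norm_wavg => // i; have [_ h] := rphi i; exact: h.
Qed.

(** In dimension one the increment of [phi] is [z' - z] times a slope between [mu] and [L]; when
    [a * L <= 1], one minus [a] times this slope lies between 0 and [1 - a * mu]. *)
Lemma gradient_step (R : realType) (mu L a : R) (phi : R -> R) (z z' : R) :
  regular_gradient mu L phi -> 0 <= a -> a * L <= 1 ->
  `|(z' - z) - a * (phi z' - phi z)| <= (1 - a * mu) * `|z' - z|.
Proof.
move=> [/(_ z z') m /(_ z z') l] a0 aL.
move: m l; set s := z' - z; set g := phi z' - phi z => m l.
have [s0|s0|s0] := ltgtP 0 s.
- rewrite gtr0_norm// in m l *.
  have ms : mu * s <= g by rewrite -(ler_pM2r s0) -mulrA.
  have ls : g <= L * s by apply: le_trans (ler_norm _) l.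
  have := ler_wpM2l a0 ms; have := ler_wpM2l a0 ls.
  have := ler_wpM2r (ltW s0) aL => h1 h2 h3.
  by rewrite ger0_norm; lra.
- rewrite ltr0_norm// in m l *.
  have s0' : 0 < - s by rewrite oppr_gt0.
  have ms : g <= mu * s.
    rewrite -lerN2 -(ler_pM2r s0'); move: m; rewrite sqrrN; lra.
  have ls : - (L * - s) <= g by move: l; rewrite ler_norml => /andP[].
  have := ler_wpM2l a0 ms; have := ler_wpM2l a0 ls.
  have := ler_wpM2r (ltW s0') aL => h1 h2 h3.
  by rewrite ler0_norm; lra.
- rewrite -s0 normr0 !mulr0 in l *.
  by move: l; rewrite normr_le0 => /eqP ->; rewrite mulr0 subr0 normr0.
Qed.

Lemma regular_gradient_continuous (R : realType) (mu L : R) (phi : R -> R) :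
  0 < L -> regular_gradient mu L phi -> continuous phi.
Proof.
move=> L0 [_ l] z; apply/cvgrPdist_le => e e0; near=> z'.
apply: (le_trans (l _ _)); rewrite mulrC -ler_pdivlMr//.
by near: z'; apply: cvgr_dist_le; [exact: cvg_id|exact: divr_gt0].
Unshelve. all: by end_near. Qed.

Lemma regular_gradient_zero (R : realType) (mu L : R) (phi : R -> R) :
  0 < mu -> 0 < L -> regular_gradient mu L phi -> exists z, phi z = 0.
Proof.
move=> mu0 L0 rphi; have cphi := regular_gradient_continuous L0 rphi.
have [m _] := rphi.
(* Monotonicity against the origin gives [phi M >= mu * M + phi 0], which this [M] makes
   nonnegative; symmetrically, [phi (- M) <= 0]. *)
pose M := `|phi 0| / mu.
have M0 : 0 <= M by rewrite divr_ge0// ltW.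
have muM : mu * M = `|phi 0| by rewrite /M mulrC divfK ?gt_eqF.
have [M00|M00] := eqVneq M 0.
  by exists 0; apply/eqP; rewrite -normr_eq0 -muM M00 mulr0.
have Mgt0 : 0 < M by rewrite lt_def M00.
have hp : 0 <= phi M.
  have := m 0 M; rewrite subr0 ger0_norm// expr2 mulrA ler_pM2r// muM.
  by have := lerNnormlW (lexx `|phi 0|); lra.
have hn : phi (- M) <= 0.
  have := m (- M) 0; rewrite sub0r opprK ger0_norm// expr2 mulrA ler_pM2r// muM.
  by have := ler_norm (phi 0); lra.
have le_NM : - M <= M by rewrite ge0_cp.
have mM : Num.min (phi (- M)) (phi M) <= 0 <= Num.max (phi (- M)) (phi M).
  by rewrite ge_min hn le_max hp orbT.
have [c _ phic] := IVT le_NM (continuous_subspaceT cphi) mM.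
by exists c.
Qed.

(** By the mean value theorem [F z - F xs] is [phi c * (z - xs)] for some [c] between them, and
    strong monotonicity gives [phi c] the sign of [c - xs]. *)
Lemma argmin_regular_gradient (R : realType) (mu L : R) (F phi : R -> R) (xs : R) :
  0 < mu -> regular_gradient mu L phi -> (forall z : R, is_derive z (1 : R) F (phi z)) ->
  phi xs = 0 -> argmin F = [set xs].
Proof.
move=> mu0 [m _] dF phi0.
have cF : continuous F.
  by move=> z; apply: differentiable_continuous; apply/derivable1_diffP; case: (dF z).
have lt_F z : z != xs -> F xs < F z.
  have sgn c : mu * `|c - xs| ^+ 2 <= phi c * (c - xs).
    by have := m xs c; rewrite phi0 subr0.
  case: (ltgtP z xs) => // zx _.
    have [c /andP[zc cx] e] := MVT zx (fun x _ => dF x) (continuous_subspaceT cF).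
    have cx0 : c - xs < 0 by rewrite subr_lt0.
    have : phi c < 0.
      have := sgn c; rewrite real_normK ?num_real// => h.
      rewrite -(nmulr_lgt0 _ cx0); apply: lt_le_trans h.
      by rewrite mulr_gt0// exprn_even_gt0//= lt_eqF.
    by move=> h; rewrite -subr_lt0 in zx; nra.
  have [c /andP[zc cx] e] := MVT zx (fun x _ => dF x) (continuous_subspaceT cF).
  have cx0 : 0 < c - xs by rewrite subr_gt0.
  have : 0 < phi c.
    have := sgn c; rewrite real_normK ?num_real// => h.
    rewrite -(pmulr_lgt0 _ cx0); apply: lt_le_trans h.
    by rewrite mulr_gt0// exprn_even_gt0//= gt_eqF.
  by move=> h; rewrite -subr_gt0 in zx; nra.
apply/seteqP; split=> z /=.
  move=> zmin; apply/eqP/negPn/negP => /lt_F.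
  by rewrite ltNge zmin.
move=> -> x; have [->|/lt_F/ltW//] := eqVneq x xs; exact: lexx.
Qed.

(** [K] is chosen before [x] and [phi], so that it serves all realizations at once. When
    [a t * L <= 1], a local step maps [[-C, C]] into itself as soon as [mu * C >= G]; before that,
    it turns a bound [C] into at most [(1 + L) * C + G]. *)
Lemma iterates_bounded (R : realType) (N : nat) (W : 'M[R]_N) (mu L G X0 : R)
    (a : nat -> R) :
  doubly_stochastic W -> 0 < mu -> 0 < L -> 0 <= G -> 0 <= X0 ->
  (forall t, 0 < a t < 1) -> a t @[t --> \oo] --> 0 ->
  exists2 K, 0 <= K & forall (x : nat -> 'I_N -> R) (phi : nat -> 'I_N -> R -> R),
    (forall i, `|x 0%N i| <= X0) ->
    (forall t j, regular_gradient mu L (phi t j)) ->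
    (forall t j, `|phi t j 0| <= G) ->
    (forall t i,
      x t.+1 i = \sum_j W i j * (x t j - a t * phi t j (x t j))) ->
    forall t i, `|x t i| <= K.
Proof.
move=> Wds mu0 L0 G0 X00 a01 a0.
have [T _ HT] : \forall t \near \oo, a t * L <= 1.
  have Li : 0 < L^-1 by rewrite invr_gt0.
  move/cvgrPdist_le : a0 => /(_ _ Li); apply: filterS => t.
  rewrite sub0r normrN => h; rewrite -ler_pdivlMr// div1r.
  exact: le_trans (ler_norm _) h.
pose k := fix k t := if t is s.+1 then (1 + L) * k s + G else X0.
have k0 t : 0 <= k t by elim: t => //= t IH; rewrite addr_ge0// mulr_ge0//; lra.
have kS t : k t <= k t.+1.
  by rewrite /= mulrDl mul1r -addrA lerDl addr_ge0// mulr_ge0// ltW.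
have kmono s t : (s <= t)%N -> k s <= k t.
  by move=> st; apply: (@homo_leq _ k <=%R) => //; exact: le_trans.
(* The first term covers the finitely many early steps, the second secures [mu * K >= G]. *)
pose K := k T + G / mu.
have kTK : k T <= K by rewrite lerDl divr_ge0// ltW.
have muK : G <= mu * K.
  by rewrite /K mulrDr [mu * (_ / _)]mulrC divfK ?gt_eqF// lerDr mulr_ge0// ltW.
exists K; first exact: le_trans kTK.
move=> x phi x0 rphi phi0 xrec.
have step t C : 0 <= C -> (forall i, `|x t i| <= C) ->
    (forall j, `|x t j - a t * phi t j (x t j)| <= (1 + L) * C + G) /\
    (a t * L <= 1 -> mu * C >= G ->
      forall j, `|x t j - a t * phi t j (x t j)| <= C).
  move=> C0 xC; have /andP[at0 at1] := a01 t.
  have low j := le_trans (ler_norm _) (phi0 t j).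
  split=> [j|aL muC j].
    have [_ l] := rphi t j; have := l 0 (x t j); rewrite subr0 => lj.
    have : `|phi t j (x t j)| <= L * C + G.
      have := ler_normD (phi t j (x t j) - phi t j 0) (phi t j 0).
      rewrite subrK => h; have := phi0 t j.
      have := ler_wpM2l (ltW L0) (xC j); lra.
    move=> h; apply: (le_trans (ler_normB _ _)).
    rewrite normrM gtr0_norm//.
    have := ler_pM (ltW at0) (normr_ge0 _) (ltW at1) h.
    have := xC j; lra.
  have := gradient_step 0 (x t j) (rphi t j) (ltW at0) aL.
  rewrite subr0 => h.
  have amu : 0 <= 1 - a t * mu.
    have := gradient_step 0 1 (rphi t j) (ltW at0) aL.
    by rewrite subr0 normr1 mulr1; apply: le_trans.
  have := ler_wpM2l amu (xC j).
  have -> : x t j - a t * phi t j (x t j) =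
    (x t j - a t * (phi t j (x t j) - phi t j 0)) - a t * phi t j 0 by ring.
  move=> h1; apply: (le_trans (ler_normB _ _)).
  rewrite normrM gtr0_norm//.
  have := ler_wpM2l (ltW at0) (phi0 t j).
  have := ler_wpM2l (ltW at0) muC; lra.
have avg t C : (forall j, `|x t j - a t * phi t j (x t j)| <= C) ->
    forall i, `|x t.+1 i| <= C.
  move=> h i; rewrite xrec; apply: ler_norm_wavg => //.
    by have [W0 _ _] := Wds; exact: W0.
  exact: doubly_stochastic_row.
have early t i : `|x t i| <= k t.
  elim: t i => [//|t IH]; apply: avg.
  by have [h _] := step t _ (k0 t) IH; exact: h.
have late n i : `|x (T + n)%N i| <= K.
  elim: n i => [i|n IH]; first by rewrite addn0 (le_trans (early _ _)).
  rewrite addnS; apply: avg.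
  have [_ h] := step (T + n)%N K (le_trans (k0 T) kTK) IH.
  by apply: h => //; apply: HT; exact: leq_addr.
move=> t i; have [tT|Tt] := leqP t T.
  by apply: (le_trans (early t i)); apply: le_trans kTK; exact: kmono.
by rewrite -(subnKC (ltnW Tt)).
Qed.

Lemma cvg0_le (R : realType) (u v : nat -> R) :
  (forall t, `|u t| <= v t) -> v t @[t --> \oo] --> 0 -> u t @[t --> \oo] --> 0.
Proof.
move=> uv /cvgrPdist_le v0; apply/cvgrPdist_le => e e0.
apply: filterS (v0 e e0) => t; rewrite !sub0r !normrN.
by apply: le_trans; apply: le_trans (uv t) (ler_norm _).
Qed.

Lemma cvg0_sum (R : realType) (I : finType) (u : I -> nat -> R) :
  (forall i, u i t @[t --> \oo] --> 0) -> \sum_i u i t @[t --> \oo] --> 0.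
Proof.
move=> u0; rewrite [X in _ --> X](_ : 0 = \sum_(i : I) (0 : R)); last by rewrite big1.
have := @cvg_big R I (fun y z => y + z) 0 xpredT (@add_continuous R) nat \oo
  (index_enum I) u (fun=> 0).
move=> h; apply: h => i _; exact: u0.
Qed.

Lemma descent_cvg (R : realType) (N : nat) (W : 'M[R]_N) (Theta : finType)
    (ths : Theta) (r mu L K xs : R) (a : nat -> R)
    (g : 'I_N -> Theta -> R -> R) (x : nat -> 'I_N -> R)
    (q : nat -> 'I_N -> Theta -> R) :
  (0 < N)%N -> doubly_stochastic W -> 0 < r < 1 ->
  (forall v : 'I_N -> R, \sum_i v i = 0 ->
    \sum_i (\sum_j W i j * v j) ^+ 2 <= r * \sum_i v i ^+ 2) ->
  0 < mu -> 0 < L -> (forall t, 0 < a t < 1) -> a t @[t --> \oo] --> 0 ->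
  (forall M, \forall n \near \oo, M <= \sum_(0 <= s < n) a s) ->
  (forall j th, regular_gradient mu L (g j th)) ->
  mean (fun j => g j ths xs) = 0 ->
  (forall t j th, 0 <= q t j th) -> (forall t j, \sum_th q t j th = 1) ->
  (forall j th, th != ths -> q t j th @[t --> \oo] --> 0) ->
  (forall t i, `|x t i| <= K) ->
  (forall t i,
    x t.+1 i = \sum_j W i j * (x t j - a t * \sum_th q t j th * g j th (x t j))) ->
  forall i, x t i @[t --> \oo] --> xs.
Proof.
move=> N0 Wds r01 Wr mu0 L0 a01 a0 adiv rg gxs q0 q1 qcv xK xrec.
pose G := \sum_j \sum_th `|g j th 0|.
have gC j th z : `|z| <= K -> `|g j th z| <= L * K + G.
  move=> zK; have [_ /(_ 0 z)] := rg j th; rewrite subr0 => l.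
  have : `|g j th 0| <= G.
    rewrite /G (bigD1 j)//= (bigD1 th)//= -addrA lerDl.
    by rewrite addr_ge0// sumr_ge0// => k _; rewrite sumr_ge0.
  have := ler_normD (g j th z - g j th 0) (g j th 0).
  by rewrite subrK; have := ler_wpM2l (ltW L0) zK; lra.
move: (L * K + G) gC => C gC.
pose dir t j := \sum_th q t j th * g j th (x t j).
have dirC t j : `|- dir t j| <= C.
  by rewrite normrN; apply: ler_norm_wavg => // th; exact: gC.
have xrec' t i : x t.+1 i = \sum_j W i j * (x t j + a t * - dir t j).
  by rewrite xrec; apply: eq_bigr => j _; rewrite mulrN.
have cons := consensus_cvg N0 Wds r01 Wr a0 dirC xrec'.
pose m t := mean (x t).
pose phi z := mean (fun j => g j ths z).
have rphi : regular_gradient mu L phi.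
  have -> : phi = (fun z => \sum_(j < N) N%:R^-1 * g j ths z).
    by apply/funext => z; rewrite /phi /mean mulr_sumr.
  apply: regular_gradient_wavg => //.
  by rewrite sumr_const card_ord -[LHS]mulr_natl divff// pnatr_eq0 -lt0n.
have mrec t : m t.+1 = m t - a t * mean (dir t).
  rewrite /m (funext (xrec' t)) mean_stochastic// meanD; congr (_ + _).
  by rewrite /mean sumrN; ring.
(* The error has two sources: belief mass outside [ths], costing at most [2 * C] per unit, and the
   disagreement [x t j - m t], costing at most [L] per unit. *)
pose e t := mean (dir t) - phi (m t).
have e0 : e t @[t --> \oo] --> 0.
  have -> : e = fun t => \sum_(j < N) N%:R^-1 * (dir t j - g j ths (m t)).
    by apply/funext => t; rewrite /e /phi /mean -mulrBr -sumrB mulr_sumr.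
  apply: cvg0_sum => j; rewrite (_ : 0 = N%:R^-1 * 0); last by rewrite mulr0.
  apply: cvgMr.
  apply: (@cvg0_le _ _ (fun t => \sum_th (if th == ths then 0 else q t j th * (2 * C))
      + L * `|x t j - m t|)) => [t|].
    rewrite -[dir t j - _](subrKA (g j ths (x t j))).
    apply: (le_trans (ler_normD _ _)); apply: lerD.
      rewrite -[X in _ - X]mul1r -[X in _ - X * _](q1 t j) mulr_suml -sumrB.
      apply: (le_trans (ler_norm_sum _ _ _)); apply: ler_sum => th _.
      case: eqP => [->|_]; first by rewrite subrr normr0.
      rewrite -mulrBr normrM (ger0_norm (q0 t j th)) ler_wpM2l//.
      apply: (le_trans (ler_normB _ _)).
      by rewrite mulr_natl mulr2n; apply: lerD; exact: gC.
    by have [_ l] := rg j ths; exact: l.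
  rewrite -[X in _ --> X](addr0 0); apply: cvgD.
    apply: cvg0_sum => th; case: eqP => [_|/eqP neq]; first exact: cvg_cst.
    by rewrite -[X in _ --> X](mul0r (2 * C)); apply: cvgMl; exact: qcv.
  rewrite -[X in _ --> X](mulr0 L); apply: cvgMr.
  by rewrite -[X in _ --> X](@normr0 _ R); apply: cvg_norm; exact: cons.
have mcv : `|m t - xs| @[t --> \oo] --> 0.
  apply: (@contraction_cvg0 _ mu a (fun t => `|e t|)) => //.
  - by move=> t; have /andP[/ltW] := a01 t.
  - have Li : 0 < mu^-1 by rewrite invr_gt0.
    move/cvgrPdist_le : (a0) => /(_ _ Li); apply: filterS => t.
    rewrite sub0r normrN => h; rewrite -ler_pdivlMl// mulr1.
    exact: le_trans (ler_norm _) h.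
  - by rewrite -[X in _ --> X](@normr0 _ R); apply: cvg_norm.
  have Li : 0 < L^-1 by rewrite invr_gt0.
  move/cvgrPdist_le : (a0) => /(_ _ Li); apply: filterS => t.
  rewrite sub0r normrN => h.
  have at0 : 0 < a t by have /andP[] := a01 t.
  have aL : a t * L <= 1.
    by rewrite -ler_pdivlMr// div1r; apply: le_trans (ler_norm _) h.
  have := gradient_step xs (m t) rphi (ltW at0) aL.
  rewrite [phi xs]gxs subr0 [mu * _]mulrC => h1.
  have -> : m t.+1 - xs = (m t - xs - a t * phi (m t)) - a t * e t.
    by rewrite mrec /e; ring.
  apply: (le_trans (ler_normB _ _)); apply: lerD => //.
  by rewrite normrM gtr0_norm.
move=> i; have -> : x^~ i = fun t => (x t i - m t) + ((m t - xs) + xs).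
  by apply/funext => t; ring.
rewrite -[X in _ --> X]add0r; apply: cvgD; first exact: cons.
rewrite -[X in _ --> X]add0r; apply: cvgD; last exact: cvg_cst.
exact: norm_cvg0.
Qed.

(** * Dynamics of the log-beliefs *)

Lemma log_pooling_gt0 (R : realType) (N : nat) (Theta : finType)
    (w : 'I_N -> R) (b : 'I_N -> Theta -> R) (th : Theta) :
  0 < log_pooling w b th.
Proof.
rewrite divr_gt0 ?expR_gt0// (bigD1 th)//= ltr_wpDr ?expR_gt0//.
by apply: sumr_ge0 => *; exact: expR_ge0.
Qed.

Lemma log_pooling_sum (R : realType) (N : nat) (Theta : finType)
    (w : 'I_N -> R) (b : 'I_N -> Theta -> R) (th0 : Theta) :
  \sum_th log_pooling w b th = 1.
Proof.
rewrite -mulr_suml divff// gt_eqF// (bigD1 th0)//= ltr_wpDr ?expR_gt0//.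
by apply: sumr_ge0 => *; exact: expR_ge0.
Qed.

(** The normalizing denominator is common to all parameters and cancels in a log-ratio, which makes
    pooling linear. *)
Lemma ln_log_pooling (R : realType) (N : nat) (Theta : finType)
    (w : 'I_N -> R) (b : 'I_N -> Theta -> R) (th th' : Theta) :
  ln (log_pooling w b th) - ln (log_pooling w b th') =
  \sum_j w j * (ln (b j th) - ln (b j th')).
Proof.
have D0 : 0 < \sum_th'' expR (\sum_(j < N) w j * ln (b j th'')).
  rewrite (bigD1 th)//= ltr_wpDr ?expR_gt0//.
  by apply: sumr_ge0 => *; exact: expR_ge0.
rewrite !ln_div ?posrE ?expR_gt0// !expRK.
under [RHS]eq_bigr do rewrite mulrBr.
by rewrite sumrB; ring.
Qed.

Lemma ln_bayes_update (R : realType) (Theta : finType) (lik q : Theta -> R) (a : R)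
    (th th' : Theta) :
  (forall th, 0 < lik th) -> (forall th, 0 < q th) ->
  ln (bayes_update lik a q th) - ln (bayes_update lik a q th') =
  (ln (q th) - ln (q th')) + a * ln (lik th / lik th').
Proof.
move=> l0 q0.
have n0 t : 0 < lik t `^ a * q t by rewrite mulr_gt0// powR_gt0.
have D0 : 0 < \sum_t lik t `^ a * q t.
  by rewrite (bigD1 th)//= ltr_wpDr//; apply: sumr_ge0 => t _; exact: ltW.
rewrite !ln_div ?posrE// !lnM ?posrE ?powR_gt0// !ln_powR; ring.
Qed.

Lemma run_q_gt0 (R : realType) (N : nat) (Theta : finType) J f (ths : Theta)
    (W : 'M[R]_N) alpha x0 eps x y b q :
  algorithm_run J f ths W alpha x0 eps x y b q ->
  forall i t th, 0 < q i t th.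
Proof.
move=> run i [|t] th; last by rewrite (run_q run) log_pooling_gt0.
by rewrite (run_q0 run) invr_gt0 ltr0n; apply/card_gt0P; exists ths.
Qed.

Lemma run_q_sum (R : realType) (N : nat) (Theta : finType) J f (ths : Theta)
    (W : 'M[R]_N) alpha x0 eps x y b q :
  algorithm_run J f ths W alpha x0 eps x y b q ->
  forall i t, \sum_th q i t th = 1.
Proof.
move=> run i [|t]; last first.
  by under eq_bigr do rewrite (run_q run); exact: (log_pooling_sum _ _ ths).
under eq_bigr do rewrite (run_q0 run).
rewrite sumr_const -[LHS]mulr_natl divff// pnatr_eq0 -lt0n.
by apply/card_gt0P; exists ths.
Qed.

(** As [q i t ths <= 1], the belief in [th] is at most its odds against [ths]. These factor as the
    exponential of a deviation from the mean log-odds, which tends to 1 by consensus, times the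
    square of the vanishing process; squaring undoes the factor one half. *)
Lemma belief_cvg0 (R : realType) (N : nat) (Theta : finType)
    (J f : 'I_N -> _) (ths th : Theta) (W : 'M[R]_N) (alpha : nat -> R)
    x0 eps x y b q (r B : R) :
  (0 < N)%N -> doubly_stochastic W -> 0 < r < 1 ->
  (forall v : 'I_N -> R, \sum_i v i = 0 ->
    \sum_i (\sum_j W i j * v j) ^+ 2 <= r * \sum_i v i ^+ 2) ->
  alpha t @[t --> \oo] --> 0 ->
  algorithm_run J f ths W alpha x0 eps x y b q ->
  (forall i t th, 0 < f i (y i t) (x i t) th) ->
  (forall i t, `|ln (f i (y i t) (x i t) th / f i (y i t) (x i t) ths)| <= B) ->
  expR (2^-1 * \sum_(s < t) alpha s *
    mean (fun i => ln (f i (y i s) (x i s) th / f i (y i s) (x i s) ths)))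
    @[t --> \oo] --> 0 ->
  forall i, q i t th @[t --> \oo] --> 0.
Proof.
move=> N0 Wds r01 Wr a0 run f0 lB Z0 i.
have q0 := run_q_gt0 run.
pose l t j := ln (f j (y j t) (x j t) th / f j (y j t) (x j t) ths).
pose lam t j := ln (q j t th) - ln (q j t ths).
have lamrec t j : lam t.+1 j = \sum_k W j k * (lam t k + alpha t * l t k).
  rewrite /lam !(run_q run) ln_log_pooling; apply: eq_bigr => k _.
  by rewrite !(run_b run) ln_bayes_update.
have cons := consensus_cvg N0 Wds r01 Wr a0 (fun t j => lB j t) lamrec.
(* There is no initial term: the initial beliefs are uniform, so their log-odds vanish. *)
have mlam t : mean (lam t) = \sum_(s < t) alpha s * mean (l s).
  elim: t => [|t IH].
    rewrite big_ord0 /mean big1 ?mulr0// => j _.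
    by rewrite /lam !(run_q0 run) subrr.
  by rewrite big_ord_recr/= -IH (funext (lamrec t)) mean_stochastic// meanD.
pose Z t := expR (2^-1 * \sum_(s < t) alpha s * mean (l s)).
have bound t : `|q i t th| <= expR (lam t i - mean (lam t)) * (Z t * Z t).
  rewrite gtr0_norm//.
  have q1 : q i t ths <= 1.
    rewrite -(run_q_sum run i t) (bigD1 ths)//= lerDl.
    by apply: sumr_ge0 => k _; exact: ltW.
  have -> : expR (lam t i - mean (lam t)) * (Z t * Z t) = q i t th / q i t ths.
    rewrite -!expRD /Z -!mlam.
    rewrite (_ : _ + _ = lam t i); last by field.
    by rewrite /lam -ln_div ?posrE// lnK// posrE divr_gt0.
  by rewrite ler_pdivlMr// ler_piMr// ltW.
apply: (cvg0_le bound).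
rewrite [X in _ --> X](_ : 0 = expR 0 * (0 * 0)); last by rewrite !mulr0.
apply: cvgM; last by apply: cvgM; exact: Z0.
by apply: continuous_cvg; [exact: continuous_expR|exact: cons].
Qed.

(** * Measurability and conditional densities *)

(** Rounding the first variable down to a grid of mesh [1 / n.+1] gives functions whose preimages
    are countable unions of rectangles; continuity in that variable makes them converge pointwise to
    [g]. *)
Lemma caratheodory_measurable (R : realType) (g : R -> R -> R) :
  (forall z, measurable_fun setT (g z)) -> (forall v, continuous (g^~ v)) ->
  measurable_fun setT (fun p : R * R => g p.1 p.2).
Proof.
move=> mg cg.
pose fl n (z : R) : int := Num.floor (n.+1%:R * z).
pose h n (p : R * R) := g ((fl n p.1)%:~R / n.+1%:R) p.2.
apply: (@measurable_fun_cvg _ _ _ setT h) => [n _ Y mY|[z v] _].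
  rewrite setTI (_ : _ @^-1` _ =
      \bigcup_(k : int) ([set z | fl n z = k] `*` (g (k%:~R / n.+1%:R) @^-1` Y))).
    apply: countable_bigcupT_measurable; first exact: countableP.
    move=> k; apply: measurableX; last by rewrite -[X in measurable X]setTI; exact: mg.
    rewrite (_ : [set z | _] = `[k%:~R / n.+1%:R, (k + 1)%:~R / n.+1%:R[%classic).
      exact: measurable_itv.
    apply/seteqP; split=> z /=; rewrite in_itv/=.
      move=> <-; rewrite ler_pdivrMr ?ltr0n// ltr_pdivlMr ?ltr0n// mulrC.
      by rewrite floor_le// floorD1_gt.
    rewrite ler_pdivrMr ?ltr0n// ltr_pdivlMr ?ltr0n// mulrC => kz.
    exact: floor_def.
  apply/seteqP; split=> [[z v] /= hY|[z v] [k _ [/= <- //]]].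
  by exists (fl n z).
rewrite /h/=.
suff fcv : (fl n z)%:~R / n.+1%:R @[n --> \oo] --> z.
  exact: (cvg_comp (fun n => (fl n z)%:~R / n.+1%:R) (g^~ v) fcv (cg v z)).
apply/cvgrPdist_le => e e0; near=> n.
have n0 : 0 < n.+1%:R :> R by rewrite ltr0n.
have -> : z - (fl n z)%:~R / n.+1%:R = (n.+1%:R * z - (fl n z)%:~R) / n.+1%:R.
  by rewrite mulrBl mulrAC divff ?mul1r// gt_eqF.
rewrite ger0_norm; last first.
  by apply: divr_ge0; [rewrite subr_ge0 floor_le|exact: ltW].
rewrite ler_pdivrMr//; apply: (@le_trans _ _ 1).
  by rewrite lerBlDr addrC; have := floorD1_gt (n.+1%:R * z); rewrite intrD => /ltW.
rewrite -ler_pdivrMl// mulr1.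
apply: (@le_trans _ _ n%:R); last by rewrite ler_nat.
by near: n; exact: nbhs_infty_ger.
Unshelve. all: by end_near. Qed.

Import HBNNSimple.

Lemma ge0_integral_density d (T : measurableType d) (R : realType)
    (mu nu : {measure set T -> \bar R}) (h : T -> R) :
  measurable_fun setT h -> (forall x, 0 <= h x) ->
  (forall A, measurable A -> nu A = (\int[mu]_(x in A) (h x)%:E)%E) ->
  forall phi : T -> \bar R, measurable_fun setT phi -> (forall x, 0 <= phi x)%E ->
  (\int[nu]_x phi x = \int[mu]_x (phi x * (h x)%:E))%E.
Proof.
move=> mh h0 nuE phi mphi phi0.
have mhE : measurable_fun setT (fun x => (h x)%:E) by exact/measurable_EFinP.
have simple (s : {nnsfun T >-> R}) :
    (\int[nu]_x (s x)%:E = \int[mu]_x ((s x)%:E * (h x)%:E))%E.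
  have mind r : measurable_fun setT
      (fun x => (r%:E * (\1_(s @^-1` [set r]) x)%:E * (h x)%:E)%E).
    apply: emeasurable_funM => //; apply: emeasurable_funM => //.
    by apply/measurable_EFinP/measurable_indic.
  rewrite integralT_nnsfun sintegralE.
  transitivity (\int[mu]_x
      \sum_(r \in range s) (r%:E * (\1_(s @^-1` [set r]) x)%:E * (h x)%:E))%E.
    rewrite ge0_integral_fsum//; last first.
      move=> r x _; apply: mule_ge0; last by rewrite lee_fin.
      exact: nnfun_muleindic_ge0.
    apply: eq_fsbigr => r; rewrite inE => -[x0 _ rE].
    have r0 : 0 <= r by rewrite -rE.
    under [RHS]eq_integral do rewrite -muleA.
    rewrite ge0_integralZl//; last 2 first.
    - apply: emeasurable_funM => //.
      by apply/measurable_EFinP/measurable_indic.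
    - by move=> x _; rewrite mule_ge0 ?lee_fin.
    rewrite nuE//; congr (_ * _)%E.
    rewrite integral_mkcond; apply: eq_integral => x _.
    by rewrite patchE indicE; case: ifPn => _; rewrite ?mul1e ?mul0e.
  apply: eq_integral => x _.
  rewrite [in RHS]fimfunE -fsumEFin// ge0_mule_fsuml//.
  by move=> r; rewrite EFinM nnfun_muleindic_ge0.
pose s_ := nnsfun_approx measurableT mphi.
have s_cvg x : (fun n => (s_ n x)%:E) @ \oo --> phi x.
  by apply: cvg_nnsfun_approx => // y _.
transitivity (limn (fun n => \int[nu]_x (s_ n x)%:E)%E).
  rewrite -monotone_convergence//.
  - by apply: eq_integral => x _; apply/esym/cvg_lim.
  - by move=> n; exact/measurable_EFinP/measurable_funP.
  - by move=> n x _; rewrite lee_fin.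
  - by move=> x _ m n mn; rewrite lee_fin; exact/lefP/nd_nnsfun_approx.
under [X in limn X]eq_fun do rewrite simple.
rewrite -monotone_convergence//.
- apply: eq_integral => x _; apply/cvg_lim => //.
  by apply: cvgeZr => //; exact: s_cvg.
- move=> n; apply: emeasurable_funM => //.
  exact/measurable_EFinP/measurable_funP.
- by move=> n x _; rewrite mule_ge0// lee_fin.
- move=> x _ m n mn; rewrite lee_wpmul2r ?lee_fin//.
  exact/lefP/nd_nnsfun_approx.
Qed.

(** The law of the pair and the measure with density [g] relative to the product of the law of [X]
    with [lambda] agree on rectangles, a generating class closed under intersection, hence
    everywhere; Tonelli then unfolds the integral. *)
Lemma integral_conditional_density d d' d'' (T : measurableType d)
    (T' : measurableType d') (V : measurableType d'') (R : realType)
    (P : probability T R) (lambda : {sigma_finite_measure set V -> \bar R})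
    (X : {mfun T >-> T'}) (Y : {mfun T >-> V}) (g : T' -> V -> R) :
  measurable_fun setT (fun p : T' * V => g p.1 p.2) ->
  (forall x v, 0 <= g x v) ->
  (forall E A, measurable E -> measurable A ->
    P (X @^-1` E `&` Y @^-1` A) =
    (\int[P]_(w in X @^-1` E) \int[lambda]_(v in A) (g (X w) v)%:E)%E) ->
  forall phi : T' * V -> \bar R, measurable_fun setT phi ->
    (forall p, 0 <= phi p)%E ->
  (\int[P]_w phi (X w, Y w) =
   \int[P]_w \int[lambda]_v (phi (X w, v) * (g (X w) v)%:E))%E.
Proof.
move=> mg g0 gE phi mphi phi0.
have mXY : measurable_fun setT (fun w => (X w, Y w)).
  by apply: measurable_fun_pair; exact: measurable_funP.
pose XY : {mfun T >-> (T' * V)%type} :=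
  HB.pack (fun w => (X w, Y w)) (isMeasurableFun.Build _ _ _ _ _ mXY).
pose mu := (distribution P X \x lambda)%E.
have mgE : measurable_fun setT (fun p : T' * V => (g p.1 p.2)%:E).
  exact/measurable_EFinP.
pose nu (S : set (T' * V)) := (\int[mu]_(p in S) (g p.1 p.2)%:E)%E.
have nu_set0 : nu set0 = 0%E by rewrite /nu integral_set0.
have nu_ge0 S : (0 <= nu S)%E by apply: integral_ge0 => *; rewrite lee_fin.
have nu_sigma : semi_sigma_additive nu.
  move=> F mF tF mUF; rewrite /nu ge0_integral_bigcup//.
  - apply: is_cvg_nneseries => n _ _; exact: nu_ge0.
  - by apply: measurable_funS mgE.
  - by move=> p _; rewrite lee_fin.
pose nuM : {measure set (T' * V) -> \bar R} :=
  HB.pack nu (isMeasure.Build _ _ _ nu nu_set0 nu_ge0 nu_sigma).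
have nuE S : measurable S -> distribution P XY S = nu S.
  move=> mS.
  pose C : set (set (T' * V)) := [set C | exists A, measurable A /\
    exists B, measurable B /\ C = A `*` B].
  apply: (@measure_unique _ _ _ C (fun=> setT) _ _ _ _ (distribution P XY) nuM) => //.
  - rewrite measurable_prod_measurableType//; congr (<<s _ >>).
    rewrite predeqE; split => [[A mA [B mB <-]]|[A [mA [B [mB ->]]]]].
      by exists A; split => //; exists B.
    by exists A => //; exists B.
  - move=> /= _ _ [X1 [mX1 [X2 [mX2 ->]]]] [Y1 [mY1 [Y2 [mY2 ->]]]].
    rewrite -setXI; exists (X1 `&` Y1); split; first exact: measurableI.
    by exists (X2 `&` Y2); split => //; exact: measurableI.
  - by move=> n; exists setT; split => //; exists setT; split => //; rewrite setXTT.
  - by rewrite bigcup_const//; exists 0%N.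
  - move=> _ [A [mA [B [mB ->]]]].
    rewrite /distribution /pushforward/= /nuM/= /nu.
    transitivity (P (X @^-1` A `&` Y @^-1` B)); first by [].
    rewrite gE// integral_mkcond [RHS]integral_mkcond.
    have mG : measurable_fun setT
        ((fun p : T' * V => (g p.1 p.2)%:E) \_ (A `*` B)).
      apply/(measurable_restrictT _ _).1; first exact: measurableX.
      by apply: measurable_funS mgE.
    have G0 p : (0 <= ((fun p : T' * V => (g p.1 p.2)%:E) \_ (A `*` B)) p)%E.
      by rewrite patchE; case: ifP => // _; rewrite lee_fin.
    rewrite fubini_tonelli1// ge0_integral_distribution; last 2 first.
    + exact: measurable_fun_fubini_tonelli_F.
    + by move=> x; apply: integral_ge0.
    apply: eq_integral => w _; rewrite /fubini_F/= patchE; case: ifPn => wA.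
      rewrite integral_mkcond; apply: eq_integral => v _.
      rewrite !patchE; congr (if _ then _ else _).
      by apply/idP/idP; rewrite !inE /=; [move=> ?; split => //; rewrite inE in wA|case].
    rewrite integral0_eq// => v _; rewrite patchE memNset//= => -[Aw _].
    by rewrite notin_setE in wA.
  - move=> k; rewrite /= probability_setT; exact: ltry.
transitivity (\int[distribution P XY]_p phi p)%E.
  by rewrite ge0_integral_distribution.
rewrite (@ge0_integral_density _ _ _ (distribution P X \x lambda)%E _ _ mg
  (fun p => g0 p.1 p.2) nuE)//.
have mphig : measurable_fun setT (fun p : T' * V => (phi p * (g p.1 p.2)%:E)%E).
  exact: emeasurable_funM.
have phig0 (p : T' * V) : (0 <= phi p * (g p.1 p.2)%:E)%E.
  by rewrite mule_ge0 ?lee_fin.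
rewrite fubini_tonelli1// ge0_integral_distribution//.
- exact: measurable_fun_fubini_tonelli_F.
- by move=> x; apply: integral_ge0.
Qed.

(** Inversion is discontinuous at 0, so it is expressed through the measurable real power; at 0 both
    sides are 0 by convention. *)
Lemma measurable_inv (R : realType) : measurable_fun setT (fun x : R => x^-1).
Proof.
rewrite (_ : (fun x : R => x^-1) = (fun x => x * (x ^+ 2) `^ (-1))).
  apply: measurable_funM => //.
  by apply: (measurableT_comp (@measurable_powR R _)); exact: measurable_funX.
apply/funext => x; rewrite powR_inv1 ?sqr_ge0//.
have [->|x0] := eqVneq x 0; first by rewrite mul0r invr0.
by field.
Qed.

Lemma measurable_div d (T : measurableType d) (R : realType) (f g : T -> R) :
  measurable_fun setT f -> measurable_fun setT g ->
  measurable_fun setT (fun x => f x / g x).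
Proof.
by move=> mf mg; apply: measurable_funM => //; exact: (measurableT_comp (@measurable_inv R)).
Qed.

(** The sigma-algebra on [T] is arbitrary, and the noise enters only through observations before
    [t]. The lemma can therefore be applied both to the ambient sigma-algebra and to the one
    generated by the past. *)
Lemma run_measurable d (T : measurableType d) (R : realType) (N : nat)
    (Theta : finType) (J : 'I_N -> R -> Theta -> R)
    (f : 'I_N -> R -> R -> Theta -> R) (ths : Theta) (W : 'M[R]_N)
    (alpha : nat -> R) (x0 : 'I_N -> R) (eps x y : 'I_N -> nat -> T -> R)
    (b q : 'I_N -> nat -> Theta -> T -> R) :
  (forall i th, measurable_fun setT (fun p : R * R => f i p.2 p.1 th)) ->
  (forall i th, measurable_fun setT (fun z => grad (J i) z th)) ->
  (forall w, algorithm_run J f ths W alpha x0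
    (fun i t => eps i t w) (fun i t => x i t w) (fun i t => y i t w)
    (fun i t th => b i t th w) (fun i t th => q i t th w)) ->
  forall t, (forall j s, (s < t)%N -> measurable_fun setT (y j s)) ->
    (forall j, measurable_fun setT (x j t)) /\
    (forall j th, measurable_fun setT (q j t th)).
Proof.
move=> mf mgrad run; elim=> [_|t IH my].
  split=> [j|j th].
    by rewrite (_ : x j 0%N = cst (x0 j))//; apply/funext => w; rewrite (run_x0 (run w)).
  rewrite (_ : q j 0%N th = cst #|Theta|%:R^-1)//.
  by apply/funext => w; rewrite (run_q0 (run w)).
have [j s st|mx mq] := IH; first by apply: my; exact: ltnW.
have myt j : measurable_fun setT (y j t) by exact: my.
have mb j th : measurable_fun setT (b j t th).
  have mlik th' : measurable_fun setT
      (fun w => f j (y j t w) (x j t w) th' `^ alpha t * q j t th' w).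
    apply: measurable_funM => //.
    apply: (measurableT_comp (@measurable_powR R _)).
    exact: measurableT_comp (mf j th') (measurable_fun_pair (mx j) (myt j)).
  rewrite (_ : b j t th = (fun w =>
      (f j (y j t w) (x j t w) th `^ alpha t * q j t th w) /
      \sum_th' (f j (y j t w) (x j t w) th' `^ alpha t * q j t th' w))).
    by apply: measurable_div => //; exact: measurable_sum.
  by apply/funext => w; rewrite (run_b (run w)).
have mqS j th : measurable_fun setT (q j t.+1 th).
  have me th' : measurable_fun setT
      (fun w => expR (\sum_(k < N) W j k * ln (b k t th' w))).
    apply: (measurableT_comp (@measurable_expR R)); apply: measurable_sum => k.
    apply: measurable_funM => //; exact: (measurableT_comp (@measurable_ln R)).
  rewrite (_ : q j t.+1 th = (fun w =>
      expR (\sum_(k < N) W j k * ln (b k t th w)) /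
      \sum_th' expR (\sum_(k < N) W j k * ln (b k t th' w)))).
    by apply: measurable_div => //; exact: measurable_sum.
  by apply/funext => w; rewrite (run_q (run w)).
split=> // j.
rewrite (_ : x j t.+1 = (fun w => \sum_k W j k *
   (x k t w - alpha t * \sum_th q k t.+1 th w * grad (J k) (x k t w) th))).
  apply: measurable_sum => k; apply: measurable_funM => //.
  apply: measurable_funB => //; apply: measurable_funM => //.
  apply: measurable_sum => th; apply: measurable_funM => //.
  exact: (measurableT_comp (mgrad k th)).
by apply/funext => w; rewrite (run_x (run w)).
Qed.

(* [lebesgue_measure] lives on [measurableTypeR R], whose display differs from
   that of the canonical structure on [R], although the measurable sets agree. *)
Lemma measurable_fun_typeR d (V : measurableType d) (R : realType) (g : R -> V) :
  measurable_fun setT g -> measurable_fun (setT : set (measurableTypeR R)) g.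
Proof. by move=> mg mD Y mY; exact: mg. Qed.

Lemma measurable_EFin_typeR (R : realType) (g : R -> R) :
  measurable_fun setT g ->
  measurable_fun (setT : set (measurableTypeR R)) (fun v => (g v)%:E).
Proof. by move=> mg; apply/measurable_EFinP; exact: measurable_fun_typeR. Qed.

Lemma measurable_comp_pair_typeR d (T : measurableType d) (R : realType)
    (X : T -> R) (p : R -> R -> R) :
  measurable_fun setT X -> measurable_fun setT (fun u : R * R => p u.1 u.2) ->
  measurable_fun setT (fun u : T * measurableTypeR R => p (X u.1) u.2).
Proof.
move=> mX mp.
have m2 : measurable_fun setT (fun u : T * measurableTypeR R => u.2 : R).
  by move=> mD Y mY; exact: measurable_snd.
have m1 : measurable_fun setT (fun u : T * measurableTypeR R => X u.1).
  exact: (measurableT_comp mX).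
exact: (measurableT_comp mp (measurable_fun_pair m1 m2)).
Qed.

(** This is the conditional expectation of [psi (X w) (Y w)], tested on an event of the past, with
    the past-measurable factor [D] pulled out. *)
Lemma conditional_density_integral d (T : measurableType d) (R : realType)
    (P : probability T R) (S : set (set T)) (X Y D : T -> R) (p psi : R -> R -> R)
    (E : set T) :
  S `<=` measurable -> measurable_fun setT Y ->
  measurable_fun (setT : set (g_sigma_algebraType S)) X ->
  measurable_fun (setT : set (g_sigma_algebraType S)) D ->
  (forall w, 0 <= D w) ->
  measurable_fun setT (fun u : R * R => p u.1 u.2) -> (forall z v, 0 <= p z v) ->
  measurable_fun setT (fun u : R * R => psi u.1 u.2) -> (forall z v, 0 <= psi z v) ->
  conditional_density P <<s S >> Y (fun w v => p (X w) v) -> <<s S >> E ->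
  (\int[P]_(w in E) (D w * psi (X w) (Y w))%:E =
   \int[P]_(w in E) ((D w)%:E *
     \int[lebesgue_measure]_v (psi (X w) v * p (X w) v)%:E))%E.
Proof.
move=> Sm mY mX mD D0 mp p0 mpsi psi0 cd GE.
have sSm : <<s S >> `<=` measurable.
  by apply: smallest_sub => //; exact: sigma_algebra_measurable.
have mid : measurable_fun setT (fun w : T => w : g_sigma_algebraType S).
  by move=> _ A mA; rewrite setTI; exact: sSm.
have mY' : measurable_fun setT (Y : T -> measurableTypeR R).
  by move=> mT A mA; exact: mY.
(* The conditioning variable is the identity map into the sample space carrying the smaller
   sigma-algebra: [E], [D] and [X] are all functions of it. *)
pose X' : {mfun T >-> g_sigma_algebraType S} :=
  HB.pack (fun w : T => w : g_sigma_algebraType S)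
          (isMeasurableFun.Build _ _ _ _ _ mid).
pose Y' : {mfun T >-> measurableTypeR R} :=
  HB.pack (Y : T -> measurableTypeR R) (isMeasurableFun.Build _ _ _ _ _ mY').
pose phi (u : g_sigma_algebraType S * measurableTypeR R) : \bar R :=
  (\1_E u.1 * D u.1 * psi (X u.1) u.2)%:E.
have phi0 u : (0 <= phi u)%E by rewrite lee_fin !mulr_ge0.
have mphi : measurable_fun setT phi.
  apply/measurable_EFinP; apply: measurable_funM.
    apply: measurable_funM.
      have m1E : measurable_fun (setT : set (g_sigma_algebraType S)) (\1_E : T -> R).
        exact: measurable_indic.
      exact: (measurableT_comp m1E).
    exact: (measurableT_comp mD).
  exact: (measurable_comp_pair_typeR mX mpsi).
have mg := measurable_comp_pair_typeR mX mp.
have cd' A B : measurable A -> measurable B ->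
    P (X' @^-1` A `&` Y' @^-1` B) =
    (\int[P]_(w in X' @^-1` A) \int[lebesgue_measure]_(v in B) (p (X w) v)%:E)%E.
  by move=> mA mB; exact: cd.
have := @integral_conditional_density _ _ _ T (g_sigma_algebraType S)
  (measurableTypeR R) R P lebesgue_measure X' Y' (fun w v => p (X w) v) mg
  (fun w v => p0 (X w) v) cd' phi mphi phi0.
rewrite /phi/= => h.
transitivity (\int[P]_w (\1_E w * D w * psi (X w) (Y w))%:E)%E.
  rewrite integral_mkcond; apply: eq_integral => w _.
  by rewrite patchE indicE; case: ifPn => _; rewrite ?mul1r// !mul0r.
rewrite h [RHS]integral_mkcond; apply: eq_integral => w _.
rewrite patchE indicE; case: ifPn => wE.
  under eq_integral do rewrite mul1r -EFinM -mulrA EFinM.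
  rewrite ge0_integralZl//.
  - apply: measurable_EFin_typeR; apply: measurable_funM.
      exact: (measurableT_comp mpsi (measurable_fun_pair (measurable_cst (X w)) _)).
    exact: (measurableT_comp mp (measurable_fun_pair (measurable_cst (X w)) _)).
  - by move=> v _; rewrite lee_fin mulr_ge0.
  - by rewrite lee_fin.
by apply: integral0_eq => v _; rewrite !mul0r mul0e.
Qed.

(** * Hellinger distance *)

(** A point where exactly one likelihood vanishes would make the extended log-ratio infinite. Where
    both vanish, the real logarithm takes its default value 0, so the bound still holds. *)
Lemma ln_ratio_bounded (R : realType) (N : nat) (Theta : finType)
    (f : 'I_N -> R -> R -> Theta -> R) (B : R) :
  0 < B -> (forall i v z th, 0 <= f i v z th) -> bounded_information f B ->
  forall i v z th th',
    (f i v z th == 0) = (f i v z th' == 0) /\ `|ln (f i v z th / f i v z th')| <= B.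
Proof.
move=> B0 f0 info i v z th th'.
have bound : f i v z th != 0 \/ f i v z th' != 0 ->
    (`|log_ratio (f i v z th) (f i v z th')| < B%:E)%E.
  move=> h; apply: le_lt_trans info; apply: ereal_sup_ubound.
  by exists i, th, th', z, v.
have := f0 i v z th; have := f0 i v z th'; move: bound.
set a := f i v z th; set c := f i v z th'; rewrite /log_ratio => bound.
rewrite [0 <= c]le_eqVlt [0 <= a]le_eqVlt => /orP[/eqP c0|c0] /orP[/eqP a0|a0].
- by rewrite -a0 -c0 eqxx mul0r ln0 // normr0; split=> //; exact: ltW.
- have := bound (or_introl (negbT (gt_eqF a0))).
  by rewrite -c0 inver eqxx gt0_muley ?lte_fin//= ltNge leey.
- have := bound (or_intror (negbT (gt_eqF c0))).
  by rewrite -a0 mul0e /= lexx/= ltNge leey.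
- rewrite !gt_eqF//; split=> //.
  have := bound (or_introl (negbT (gt_eqF a0))).
  by rewrite inver gt_eqF// -EFinM lne_EFin ?divr_gt0//= lte_fin => /ltW.
Qed.

Definition hellinger (R : realType) (p r : R -> R) : \bar R :=
  (\int[lebesgue_measure]_v ((Num.sqrt (p v) - Num.sqrt (r v)) ^+ 2)%:E)%E.

Lemma measurable_sqrt (R : realType) : measurable_fun setT (@Num.sqrt R).
Proof. by apply: continuous_measurable_fun; exact: sqrt_continuous. Qed.

Lemma measurable_hellinger_density (R : realType) (p r : R -> R) :
  measurable_fun setT p -> measurable_fun setT r ->
  measurable_fun setT (fun v => (Num.sqrt (p v) - Num.sqrt (r v)) ^+ 2).
Proof.
move=> mp mr; apply: measurable_funX; apply: measurable_funB.
  exact: (measurableT_comp (@measurable_sqrt R)).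
exact: (measurableT_comp (@measurable_sqrt R)).
Qed.

Lemma hellinger_ge0 (R : realType) (p r : R -> R) : (0 <= hellinger p r)%E.
Proof. by apply: integral_ge0 => v _; rewrite lee_fin sqr_ge0. Qed.

(** The first term is [Num.sqrt (a * b)], so this is the defect in the arithmetic-geometric mean
    inequality. The common zeros exclude [b = 0 < a], where the default [ln 0 = 0] would give [a]
    instead of 0. *)
Lemma expR_half_ln_ratio (R : realType) (a b : R) :
  0 <= a -> 0 <= b -> (a == 0) = (b == 0) ->
  expR (2^-1 * ln (b / a)) * a + 2^-1 * (Num.sqrt a - Num.sqrt b) ^+ 2 =
  2^-1 * (a + b).
Proof.
move=> a0 b0 ab.
have -> : expR (2^-1 * ln (b / a)) * a = Num.sqrt a * Num.sqrt b.
  have [aE|an0] := eqVneq a 0; first by rewrite aE mulr0 sqrtr0 mul0r.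
  have agt0 : 0 < a by rewrite lt_def an0.
  have bgt0 : 0 < b by rewrite lt_def -ab an0.
  have -> : expR (2^-1 * ln (b / a)) = Num.sqrt b / Num.sqrt a.
    rewrite -sqrtrV// -sqrtrM// -powR12_sqrt ?divr_ge0//.
    by rewrite /powR gt_eqF// divr_gt0.
  rewrite -[X in _ * X](sqr_sqrtr a0).
  by field; rewrite gt_eqF// sqrtr_gt0.
move: (Num.sqrt a) (Num.sqrt b) (sqr_sqrtr a0) (sqr_sqrtr b0) => s t <- <-.
by field.
Qed.

(** The affinity is 1 minus half the squared distance; the additive form avoids an extended-real
    subtraction. *)
Lemma half_likelihood_hellinger (R : realType) (p r : R -> R) :
  is_density p -> is_density r -> (forall v, (p v == 0) = (r v == 0)) ->
  (\int[lebesgue_measure]_v (expR (2^-1 * ln (r v / p v)) * p v)%:E +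
   (2^-1)%:E * hellinger p r = 1)%E.
Proof.
move=> [mp p0 p1] [mr r0 r1] pr.
have mh := measurable_hellinger_density mp mr.
have mexp : measurable_fun setT (fun v => expR (2^-1 * ln (r v / p v)) * p v).
  apply: measurable_funM => //.
  apply: (measurableT_comp (@measurable_expR R)).
  apply: measurable_funM => //.
  apply: (measurableT_comp (@measurable_ln R)).
  exact: measurable_div.
rewrite /hellinger -ge0_integralZl//=; last 2 first.
- exact: measurable_EFin_typeR.
- by move=> v _; rewrite lee_fin sqr_ge0.
rewrite -ge0_integralD//=; last 4 first.
- by move=> v _; rewrite lee_fin mulr_ge0// expR_ge0.
- exact: measurable_EFin_typeR.
- by move=> v _; rewrite lee_fin mulr_ge0// sqr_ge0.
- by apply: measurable_EFin_typeR; exact: measurable_funM.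
under eq_integral do rewrite -EFinM -EFinD expR_half_ln_ratio// EFinM EFinD.
rewrite ge0_integralZl//=; last 2 first.
- by apply: measurable_EFin_typeR; exact: measurable_funD.
- by move=> v _; rewrite lee_fin addr_ge0.
rewrite ge0_integralD//=; last 4 first.
- by move=> v _; rewrite lee_fin.
- exact: measurable_EFin_typeR.
- by move=> v _; rewrite lee_fin.
- exact: measurable_EFin_typeR.
by rewrite p1 r1 -EFinD -EFinM; congr EFin; field.
Qed.

(** At squared distance 0 the densities agree almost everywhere, and the divergence integrand
    vanishes there. The common zeros keep this integrand finite. *)
Lemma hellinger_gt0 (R : realType) (p r : R -> R) :
  is_density p -> is_density r -> (forall v, (p v == 0) = (r v == 0)) ->
  (0 < kl_div p r)%E -> (0 < hellinger p r)%E.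
Proof.
move=> [mp p0 p1] [mr r0 r1] pr; rewrite !lt_def hellinger_ge0 andbT => /andP[kl0 _].
apply: contra kl0 => /eqP H0; apply/eqP.
have mh := measurable_hellinger_density mp mr.
have ae : ae_eq lebesgue_measure setT
    (fun v => ((Num.sqrt (p v) - Num.sqrt (r v)) ^+ 2)%:E) (cst 0%E).
  apply/ae_eq_integral_abs => //; first exact: measurable_EFin_typeR.
  rewrite -[RHS]H0; apply: eq_integral => v _.
  by rewrite gee0_abs// lee_fin sqr_ge0.
have klE v : ((p v)%:E * log_ratio (p v) (r v))%E = (p v * ln (p v / r v))%:E.
  rewrite /log_ratio; have [->|pn0] := eqVneq (p v) 0; first by rewrite mul0e mul0r.
  have rn0 : r v != 0 by rewrite -pr.
  have pg : 0 < p v by rewrite lt_def pn0 p0.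
  have rg : 0 < r v by rewrite lt_def rn0 r0.
  by rewrite inver (negbTE rn0) -EFinM lne_EFin// divr_gt0.
rewrite /kl_div; under eq_integral do rewrite klE.
rewrite (@ae_eq_integral _ _ _ lebesgue_measure setT (cst 0%E)) ?integral0//.
  apply: measurable_EFin_typeR; apply: measurable_funM => //.
  by apply: (measurableT_comp (@measurable_ln R)); exact: measurable_div.
apply: filterS ae => v /(_ I)/= -[/eqP]; rewrite sqrf_eq0 subr_eq0 => /eqP e _ /=.
have -> : p v = r v by rewrite -(sqr_sqrtr (p0 v)) e sqr_sqrtr.
by have [->|rn0] := eqVneq (r v) 0; rewrite ?mul0r// divff// ln1 mulr0.
Qed.

Lemma hellinger_lower_bound (R : realType) (p r : R -> R -> R) (K : R) :
  (forall z, measurable_fun setT (p z)) -> (forall z, measurable_fun setT (r z)) ->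
  (forall v, continuous (p^~ v)) -> (forall v, continuous (r^~ v)) ->
  (forall z, 0 < hellinger (p z) (r z))%E ->
  exists2 c : R, 0 < c & forall z, `|z| <= K -> (c%:E <= hellinger (p z) (r z))%E.
Proof.
(* Otherwise decisions in the interval with squared distance below [n.+1%:R^-1] have a limit point,
   at which Fatou's lemma forces the distance to be 0. *)
move=> mp mr cp cr H0; apply: contrapT => noc.
have small n : exists z, `|z| <= K /\ (hellinger (p z) (r z) < n.+1%:R^-1%:E)%E.
  apply: contrapT => noz; apply: noc; exists n.+1%:R^-1; first by rewrite invr_gt0.
  by move=> z zK; rewrite leNgt; apply/negP => h; apply: noz; exists z.
have [u uP] := choice small.
have ubd : bounded_fun u.
  exists K; split; first exact: num_real.
  by move=> M KM n _ /=; have [h _] := uP n; exact: le_trans (ltW KM).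
have [s sinc /cvg_ex[/= z uz]] := bolzano_weierstrass ubd.
have hcv v : ((Num.sqrt (p (u (s n)) v) - Num.sqrt (r (u (s n)) v)) ^+ 2)%:E
    @[n --> \oo] --> ((Num.sqrt (p z v) - Num.sqrt (r z v)) ^+ 2)%:E.
  apply: cvg_EFin; first exact: nearW.
  have pc : Num.sqrt (p (u (s n)) v) @[n --> \oo] --> Num.sqrt (p z v).
    apply: continuous_cvg; first exact: sqrt_continuous.
    by apply: (cvg_comp _ (p^~ v) uz); exact: cp.
  have rc : Num.sqrt (r (u (s n)) v) @[n --> \oo] --> Num.sqrt (r z v).
    apply: continuous_cvg; first exact: sqrt_continuous.
    by apply: (cvg_comp _ (r^~ v) uz); exact: cr.
  rewrite expr2; under eq_fun do rewrite /= expr2.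
  by apply: cvgM; apply: cvgB.
have := @fatou _ _ R lebesgue_measure setT measurableT
  (fun n v => ((Num.sqrt (p (u (s n)) v) - Num.sqrt (r (u (s n)) v)) ^+ 2)%:E).
have mh n := measurable_hellinger_density (mp (u (s n))) (mr (u (s n))).
move=> /(_ (fun n => measurable_EFin_typeR (mh n))).
move=> /(_ (fun n v _ => ltac:(by rewrite lee_fin sqr_ge0))).
have -> : (\int[lebesgue_measure]_v limn_einf (fun n =>
    ((Num.sqrt (p (u (s n)) v) - Num.sqrt (r (u (s n)) v)) ^+ 2)%:E) =
    hellinger (p z) (r z))%E.
  by apply: eq_integral => v _; rewrite (cvg_limn_einf_sup (hcv v)).
have lim0 : hellinger (p (u (s n))) (r (u (s n))) @[n --> \oo] --> 0%E.
  have n_le_s n : (n <= s n)%N.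
    elim: n => // n IH; apply: (leq_ltn_trans IH).
    by have := sinc n.+1 n; rewrite leEnat ltnn => /negbT; rewrite -ltnNge.
  apply: (@squeeze_cvge _ _ _ _ (cst 0%E) _ (fun n => (harmonic n)%:E)).
  - apply: nearW => n; rewrite hellinger_ge0/=.
    apply: (@le_trans _ _ (s n).+1%:R^-1%:E); first by apply/ltW; have [] := uP (s n).
    by rewrite lee_fin lef_pV2 ?posrE ?ltr0n// ler_nat ltnS.
  - exact: cvg_cst.
  - by apply: cvg_EFin; [exact: nearW|exact: cvg_harmonic].
rewrite (cvg_limn_einf_sup lim0) => h; have := H0 z; rewrite lt_neqAle => /andP[].
by rewrite eq_le h hellinger_ge0.
Qed.

(** * Nonnegative supermartingales *)

(* Ville: on the event that Z has stayed below e, trade mass of Z for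
   probability of having crossed e. *)
Lemma supermartingale_maximal d (T : measurableType d) (R : realType)
    (P : probability T R) (Z : nat -> T -> R) (G : nat -> set (set T)) (e : R)
    (t : nat) :
  0 < e -> (forall s, measurable_fun setT (Z s)) -> (forall s w, 0 <= Z s w) ->
  (forall s, G s setT) -> (forall s, setI_closed (G s)) ->
  (forall s, G s `<=` G s.+1) -> (forall s, G s `<=` measurable) ->
  (forall s, G s [set w | Z s w < e]) ->
  (forall s E, G s E ->
    \int[P]_(w in E) (Z s.+1 w)%:E <= \int[P]_(w in E) (Z s w)%:E)%E ->
  (e%:E * P (\bigcup_k [set w | (e <= Z (t + k)%N w)%R]) <= \int[P]_w (Z t w)%:E)%E.
Proof.
move=> e0 mZ Z0 GT GI GS Gm GZ super.
(* [A k] constrains only the times [t] to [t + k - 1]; hence [A k.+1] already belongs to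
   [G (t + k)], where the supermartingale inequality is applied. *)
pose A := fix A k := if k is s.+1 then A s `&` [set w | Z (t + s)%N w < e] else setT.
have GA k : G (t + k)%N (A k).
  elim: k => [|k IH] /=; first exact: GT.
  by rewrite addnS; apply: GS; apply: GI.
have mA k : measurable (A k) by apply: Gm; exact: GA.
have mZE s D : measurable_fun D (fun w => (Z s w)%:E).
  by apply/measurable_EFinP; exact: measurable_funTS.
(* [V] is the expectation of the process stopped at its first crossing, with its value there
   replaced by [e]. *)
pose V k := (e%:E * P (~` A k) + \int[P]_(w in A k) (Z (t + k)%N w)%:E)%E.
have V0 : V 0%N = (\int[P]_w (Z t w)%:E)%E.
  by rewrite /V/= setCT measure0 mule0 add0e addn0.
have VS k : (V k.+1 <= V k)%E.
  pose F := A k `&` [set w | e <= Z (t + k)%N w].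
  have AkE : A k = A k.+1 `|` F.
    rewrite /= /F -setIUr (_ : _ `|` _ = setT) ?setIT//.
    by apply/seteqP; split=> // w _ /=; case: (ltP (Z (t + k)%N w) e); [left|right].
  have mF : measurable F.
    rewrite (_ : F = A k `\` A k.+1); first exact: measurableD.
    apply/seteqP; split=> w /=.
      by move=> [Aw eZ]; split=> // -[_]; rewrite ltNge eZ.
    by move=> [Aw nA]; split=> //=; rewrite leNgt; apply/negP => h; apply: nA.
  have AF : [disjoint A k.+1 & F].
    by apply/disj_setPS => w /= [[_ h1] [_ h2]]; move: h1; rewrite ltNge h2.
  have CE : ~` A k.+1 = ~` A k `|` F.
    apply/seteqP; split=> w /=.
      move=> nA; have [Aw|] := pselect (A k w); last by left.
      by right; split=> //=; rewrite leNgt; apply/negP => h; apply: nA.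
    by move=> [nA [/nA//]|[_ h1] [_ h2]]; move: h2; rewrite ltNge h1.
  rewrite /V CE measureU//; last first.
    - by apply/seteqP; split=> // w [/= nA [/nA]].
    - exact: measurableC.
  rewrite muleDr ?ge0_adde_def ?inE// -addeA leeD2l//.
  rewrite [in leRHS]AkE ge0_integral_setU//; last by move=> w _; rewrite lee_fin.
  rewrite addeC addnS leeD//.
    by apply: super; have := GA k.+1; rewrite addnS => ?; apply: GI => //; exact: GZ.
  rewrite -integral_cst//; apply: ge0_le_integral => //.
  - by move=> w _; rewrite lee_fin ltW.
  - by move=> w [_ h]; rewrite lee_fin.
have VT k : (e%:E * P (~` A k) <= \int[P]_w (Z t w)%:E)%E.
  rewrite -V0; apply: (@le_trans _ _ (V k)).
    by rewrite leeDl// integral_ge0// => w _; rewrite lee_fin.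
  by elim: k => // k IH; exact: le_trans (VS k) IH.
have CA : \bigcup_k ~` A k = \bigcup_k [set w | e <= Z (t + k)%N w].
  apply/seteqP; split=> w [k _ /= h].
    elim: k h => [h|k IH h]; first by exfalso; exact: h.
    have [Aw|/IH//] := pselect (A k w).
    by exists k => //=; rewrite leNgt; apply/negP => h1; apply: h.
  by exists k.+1 => //= -[_]; rewrite ltNge h.
rewrite -CA.
have cv : (e%:E * P (~` A k))%E @[k --> \oo] --> (e%:E * P (\bigcup_k ~` A k))%E.
  apply: cvgeZl => //; apply: nondecreasing_cvg_mu.
  - by move=> k; exact: measurableC.
  - by apply: bigcupT_measurable => k; exact: measurableC.
  - apply/nondecreasing_seqP => k; rewrite subsetEset.
    by apply: subsetC => w [].
by apply: (cvge_to_le cv); exact: nearW.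
Qed.

Lemma supermartingale_cvg0 d (T : measurableType d) (R : realType)
    (P : probability T R) (Z : nat -> T -> R) (G : nat -> set (set T))
    (c : R) (a : nat -> R) :
  (forall s, measurable_fun setT (Z s)) -> (forall s w, 0 <= Z s w) ->
  (forall w, Z 0%N w = 1) ->
  (forall s, G s setT) -> (forall s, setI_closed (G s)) ->
  (forall s, G s `<=` G s.+1) -> (forall s, G s `<=` measurable) ->
  (forall s e, G s [set w | Z s w < e]) ->
  0 < c -> (forall s, 0 <= a s) -> (forall s, c * a s <= 1) ->
  (forall M, \forall n \near \oo, M <= \sum_(0 <= s < n) a s) ->
  (forall s E, G s E ->
    \int[P]_(w in E) (Z s.+1 w)%:E <=
    (1 - c * a s)%:E * \int[P]_(w in E) (Z s w)%:E)%E ->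
  \forall w \ae P, Z t w @[t --> \oo] --> 0.
Proof.
move=> mZ Z0 Z1 GT GI GS Gm GZ c0 a0 ca1 adiv contr.
have int_ge0 s E : (0 <= \int[P]_(w in E) (Z s w)%:E)%E.
  by apply: integral_ge0 => w _; rewrite lee_fin.
have super s E : G s E ->
    (\int[P]_(w in E) (Z s.+1 w)%:E <= \int[P]_(w in E) (Z s w)%:E)%E.
  move=> GE; apply: (le_trans (contr s E GE)); rewrite -[leRHS]mul1e.
  by apply: lee_wpmul2r => //; rewrite lee_fin gerBl mulr_ge0// ltW.
have fin t : (\int[P]_w (Z t w)%:E \is a fin_num)%E.
  rewrite ge0_fin_numE//; apply: (@le_lt_trans _ _ 1%E); last exact: ltry.
  elim: t => [|t IH]; last by apply: le_trans IH; exact: super.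
  under eq_integral do rewrite Z1.
  by rewrite integral_cst//= mul1e probability_setT.
pose u t := fine (\int[P]_w (Z t w)%:E)%E.
have u0 : u t @[t --> \oo] --> 0.
  apply: (@contraction_cvg0 _ c a (cst 0)) => //.
  - exact: nearW.
  - exact: cvg_cst.
  - by move=> t; apply: fine_ge0.
  - apply: nearW => t; rewrite mulr0 addr0 -lee_fin EFinM !fineK//.
    exact: contr.
(* [bad k] says that [Z] is at least [k.+1%:R^-1] infinitely often. It lies in the crossing event
   after any time [t], so its probability is at most [k.+1%:R * u t], which tends to 0. *)
pose bad (k : nat) := \bigcap_t \bigcup_s [set w | k.+1%:R^-1 <= Z (t + s)%N w].
have mbadt (k t : nat) :
    measurable (\bigcup_s [set w | k.+1%:R^-1 <= Z (t + s)%N w]).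
  apply: bigcupT_measurable => s; rewrite -[X in measurable X]setTI.
  exact: (measurable_fun_ler (measurable_cst _) (mZ _)).
have bad0 k : P.-negligible (bad k).
  have k0 : (0 : R) < k.+1%:R^-1 by rewrite invr_gt0 ltr0n.
  exists (bad k); split=> //; first exact: bigcapT_measurable.
  apply/eqP; rewrite eq_le measure_ge0 andbT.
  have le_u t : (P (bad k) <= (k.+1%:R * u t)%:E)%E.
    apply: (@le_trans _ _ (P (\bigcup_s [set w | k.+1%:R^-1 <= Z (t + s)%N w]))).
      by apply: le_measure; rewrite ?inE//; [exact: bigcapT_measurable|move=> w; apply].
    have := supermartingale_maximal t k0 mZ Z0 GT GI GS Gm (fun s => GZ s _) super.
    rewrite -(fineK (fin t)) -/(u t) -lee_pdivlMl// invrK => h.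
    by apply: (le_trans h); rewrite EFinM.
  have cv : (k.+1%:R * u t)%:E @[t --> \oo] --> (k.+1%:R * 0 : R)%:E.
    by apply: cvg_EFin; [exact: nearW|exact: cvgMr].
  rewrite mulr0 in cv; apply: (cvge_to_ge cv); exact: nearW.
have [M [mM M0 badM]] := negligible_bigcup bad0.
exists M; split=> // w /= nconv; apply: badM; apply: contrapT => good; apply: nconv.
apply/cvgrPdist_lt => e e0.
pose k := Num.truncn e^-1.
have ke : k.+1%:R^-1 < e.
  by rewrite invf_plt ?posrE ?ltr0n//; exact: truncnS_gt.
have [t ht] : exists t, forall s, Z (t + s)%N w < k.+1%:R^-1.
  apply: contrapT => h; apply: good; exists k => // t _.
  apply: contrapT => h'; apply: h; exists t => s.
  by rewrite ltNge; apply/negP => h2; apply: h'; exists s.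
exists t => // s /= ts; rewrite sub0r normrN ger0_norm//.
by rewrite -(subnKC ts); apply: lt_trans ke.
Qed.

(** * Almost sure concentration of the beliefs *)

(** Jensen's inequality with weight [1 - a] at 0 and [a / N] at each [u i]. It trades an exponent
    that varies with the stepsize for a fixed one, and a product over agents for a mean. *)
Lemma expR_mean_le (R : realType) (N : nat) (a : R) (u : 'I_N -> R) :
  (0 < N)%N -> 0 <= a <= 1 ->
  expR (a * mean u) <= (1 - a) + a * mean (fun i => expR (u i)).
Proof.
move=> N0 /andP[a0 a1]; set m := a * mean u.
(* the tangent line of exp at m lies below exp *)
have tangent z : expR m * (1 + (z - m)) <= expR z.
  rewrite -[in leRHS](subrKC m z) expRD ler_wpM2l ?expR_ge0//.
  exact: expR_ge1Dx.
have t0 : expR m * (1 - m) <= 1 by have := tangent 0; rewrite expR0 sub0r.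
have tm : expR m * (1 - m + mean u) <= mean (fun i => expR (u i)).
  rewrite (_ : expR m * _ = mean (fun i => expR m * (1 + (u i - m)))).
    by rewrite /mean ler_wpM2l ?invr_ge0// ler_sum.
  rewrite [in RHS]/mean -mulr_sumr big_split/= sumrB !sumr_const card_ord.
  rewrite -[m *+ _]mulr_natr /mean; field.
  by rewrite pnatr_eq0 -lt0n.
have := ler_wpM2l a0 tm; have := ler_wpM2l (_ : 0 <= 1 - a) t0.
rewrite subr_ge0 => /(_ a1); rewrite /m; lra.
Qed.

(** The agents' bounds combine linearly, each through its own factor [kappa i]; one factor below 1
    lowers the total when the others are at most 1. *)
Lemma mixture_integral_le d (T : measurableType d) (R : realType)
    (P : {measure set T -> \bar R}) (N : nat) (a : R) (kappa : 'I_N -> R)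
    (D D' : T -> R) (h : 'I_N -> T -> R) (E : set T) :
  (0 < N)%N -> 0 <= a <= 1 -> measurable E -> measurable_fun setT D ->
  measurable_fun setT D' -> (forall i, measurable_fun setT (h i)) ->
  (forall w, 0 <= D w) -> (forall w, 0 <= D' w) -> (forall i w, 0 <= h i w) ->
  (forall i, 0 <= kappa i) ->
  (forall w, D' w <= D w * ((1 - a) + a * mean (h^~ w))) ->
  (forall i, \int[P]_(w in E) (D w * h i w)%:E <=
    (kappa i)%:E * \int[P]_(w in E) (D w)%:E)%E ->
  (\int[P]_(w in E) (D' w)%:E <=
    (1 - a + a * mean kappa)%:E * \int[P]_(w in E) (D w)%:E)%E.
Proof.
move=> N0 /andP[a0 a1] mE mD mD' mh D0 D'0 h0 k0 D'D hk.
have sub g : measurable_fun setT g -> measurable_fun E (fun w => (g w : R)%:E).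
  by move=> mg; apply/measurable_EFinP; exact: measurable_funTS.
have mDh i : measurable_fun setT (fun w => D w * h i w) by exact: measurable_funM.
have Dh0 i w : 0 <= D w * h i w by rewrite mulr_ge0.
apply: (@le_trans _ _ (\int[P]_(w in E) ((1 - a)%:E * (D w)%:E +
    \sum_i (a * N%:R^-1)%:E * (D w * h i w)%:E))%E).
  have rE w : ((1 - a)%:E * (D w)%:E + \sum_i (a * N%:R^-1)%:E * (D w * h i w)%:E)%E =
      (D w * ((1 - a) + a * mean (h^~ w)))%:E.
    under eq_bigr do rewrite -EFinM.
    rewrite sumEFin -EFinM -EFinD; congr EFin.
    by rewrite -mulr_sumr -mulr_sumr /mean; ring.
  under [leRHS]eq_integral do rewrite rE.
  apply: ge0_le_integral => //.
  - by move=> w _; rewrite lee_fin.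
  - exact: sub.
  - apply: sub; apply: measurable_funM => //; apply: measurable_funD => //.
    by apply: measurable_funM => //; apply: measurable_funM => //; exact: measurable_sum.
  - by move=> w _; rewrite lee_fin.
have aN0 : 0 <= a * N%:R^-1 by rewrite mulr_ge0// invr_ge0.
have a1' : 0 <= 1 - a by rewrite subr_ge0.
rewrite ge0_integralD//; last 4 first.
- by move=> w _; rewrite mule_ge0// lee_fin.
- exact/emeasurable_funM/sub.
- by move=> w _; apply: sume_ge0 => i _; rewrite mule_ge0// lee_fin.
- by apply: emeasurable_sum => i; apply: emeasurable_funM => //; exact: sub.
rewrite ge0_integralZl//; last 2 first.
- exact: sub.
- by move=> w _; rewrite lee_fin.
rewrite ge0_integral_sum//; last 2 first.
- by move=> i; apply: emeasurable_funM => //; exact: sub.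
- by move=> i w _; rewrite mule_ge0// lee_fin.
rewrite [in leRHS](EFinD (1 - a)) [in leRHS]ge0_muleDl; last 2 first.
- by rewrite lee_fin.
- by rewrite lee_fin /mean; do 2 apply: mulr_ge0 => //; exact: sumr_ge0.
rewrite leeD2l//.
rewrite /mean mulrA mulr_sumr -sumEFin ge0_sume_distrl; last first.
  by move=> i _; rewrite lee_fin mulr_ge0.
apply: lee_sum => i _; rewrite ge0_integralZl//.
- rewrite (EFinM (a / N%:R)) -muleA; apply: lee_wpmul2l; last exact: hk.
  by rewrite lee_fin.
- exact: sub.
- by move=> w _; rewrite lee_fin.
Qed.

(** The generators of [past], named so that the sample space can be equipped with the sigma-algebra
    they generate. *)
Definition past_events (R : realType) (T : Type) (N : nat)
    (x y : 'I_N -> nat -> T -> R) (t : nat) : set (set T) :=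
  [set E | exists j s U, [/\ (s < t)%N, measurable U &
         E = x j s @^-1` U \/ E = y j s @^-1` U] ].

Lemma past_eventsS (R : realType) (T : Type) (N : nat)
    (x y : 'I_N -> nat -> T -> R) (t : nat) :
  past_events x y t `<=` past_events x y t.+1.
Proof.
by move=> E [j [s [U [st mU EU]]]]; exists j, s, U; split=> //; exact: ltnW.
Qed.

Lemma measurable_past_x d (T : measurableType d) (R : realType) (N : nat)
    (x y : 'I_N -> nat -> T -> R) (t s : nat) (j : 'I_N) : (s < t)%N ->
  measurable_fun (setT : set (g_sigma_algebraType (past_events x y t))) (x j s).
Proof.
move=> st _ U mU; rewrite setTI; apply: sub_sigma_algebra.
by exists j, s, U; split=> //; left.
Qed.

Lemma measurable_past_y d (T : measurableType d) (R : realType) (N : nat)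
    (x y : 'I_N -> nat -> T -> R) (t s : nat) (j : 'I_N) : (s < t)%N ->
  measurable_fun (setT : set (g_sigma_algebraType (past_events x y t))) (y j s).
Proof.
move=> st _ U mU; rewrite setTI; apply: sub_sigma_algebra.
by exists j, s, U; split=> //; right.
Qed.

Lemma past_events_measurable d (T : measurableType d) (R : realType) (N : nat)
    (x y : 'I_N -> nat -> T -> R) (t : nat) :
  (forall j s, measurable_fun setT (x j s)) ->
  (forall j s, measurable_fun setT (y j s)) ->
  past_events x y t `<=` measurable.
Proof.
move=> mx my E [j [s [U [_ mU [|] ->]]]]; rewrite -[X in measurable X]setTI.
  exact: mx.
exact: my.
Qed.

(** The indicator of a zero likelihood integrates to 0 against that likelihood. Positivity at the
    actual observations is what allows logarithms in the belief recursion. *)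
Lemma likelihood_gt0_ae d (T : measurableType d) (R : realType)
    (P : probability T R) (S : set (set T)) (X Y : T -> R) (p : R -> R -> R) :
  S `<=` measurable -> measurable_fun setT X -> measurable_fun setT Y ->
  measurable_fun (setT : set (g_sigma_algebraType S)) X ->
  measurable_fun setT (fun u : R * R => p u.1 u.2) -> (forall z v, 0 <= p z v) ->
  conditional_density P <<s S >> Y (fun w v => p (X w) v) ->
  \forall w \ae P, 0 < p (X w) (Y w).
Proof.
move=> Sm mXT mY mX mp p0 cd.
pose psi z v : R := \1_[set 0] (p z v).
have mpsi : measurable_fun setT (fun u : R * R => psi u.1 u.2).
  have m0 : measurable_fun setT (\1_[set 0] : R -> R) by exact: measurable_indic.
  exact: (measurableT_comp m0 mp).
have psi0 z v : 0 <= psi z v by [].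
have cd1 : <<s S >> setT by exact: (@measurableT _ (g_sigma_algebraType S)).
have D0 (w : T) : 0 <= (cst 1 : T -> R) w by [].
have := conditional_density_integral Sm mY mX (measurable_cst (1 : R)) D0 mp p0
  mpsi psi0 cd cd1.
under eq_integral do rewrite mul1r.
have inner w : (\int[lebesgue_measure]_v (psi (X w) v * p (X w) v)%:E = 0)%E.
  apply: integral0_eq => v _; rewrite /psi indicE.
  have [->|pn0] := eqVneq (p (X w) v) 0; first by rewrite mulr0.
  by rewrite memNset ?mul0r//; exact/eqP.
under [RHS]eq_integral do rewrite inner mule0.
rewrite integral0 => int0.
have mpXY : measurable_fun setT (fun w => p (X w) (Y w)).
  exact: (measurableT_comp mp (measurable_fun_pair mXT mY)).
have mA : measurable ((fun w => p (X w) (Y w)) @^-1` [set 0]).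
  by rewrite -[X in measurable X]setTI; exact: mpXY.
exists ((fun w => p (X w) (Y w)) @^-1` [set 0]); split=> //.
  by rewrite -int0 -[X in P X]setIT -integral_indic.
by move=> w /= /negP; rewrite lt_def p0 andbT negbK => /eqP.
Qed.

Lemma measurable_half_likelihood (R : realType) (p r : R -> R -> R) :
  measurable_fun setT (fun u : R * R => p u.1 u.2) ->
  measurable_fun setT (fun u : R * R => r u.1 u.2) ->
  measurable_fun setT (fun u : R * R => expR (2^-1 * ln (r u.1 u.2 / p u.1 u.2))).
Proof.
move=> mp mr; apply: (measurableT_comp (@measurable_expR R)).
apply: measurable_funM => //; apply: (measurableT_comp (@measurable_ln R)).
exact: measurable_div.
Qed.

(** Given the past, the half-power ratio has expectation 1 minus half the squared Hellinger distance
    at the current decision. The case [c = 0] serves the agents that may be uninformative. *)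
Lemma half_likelihood_integral_le d (T : measurableType d) (R : realType)
    (P : probability T R) (S : set (set T)) (X Y D : T -> R) (p r : R -> R -> R)
    (c K : R) (E : set T) :
  S `<=` measurable -> measurable_fun setT X -> measurable_fun setT Y ->
  measurable_fun setT D ->
  measurable_fun (setT : set (g_sigma_algebraType S)) X ->
  measurable_fun (setT : set (g_sigma_algebraType S)) D ->
  (forall w, 0 <= D w) -> (forall w, `|X w| <= K) ->
  measurable_fun setT (fun u : R * R => p u.1 u.2) ->
  measurable_fun setT (fun u : R * R => r u.1 u.2) ->
  (forall z, is_density (p z)) -> (forall z, is_density (r z)) ->
  (forall z v, (p z v == 0) = (r z v == 0)) ->
  conditional_density P <<s S >> Y (fun w v => p (X w) v) -> <<s S >> E ->
  0 <= c <= 1 -> (forall z, `|z| <= K -> (c%:E <= hellinger (p z) (r z))%E) ->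
  (\int[P]_(w in E) (D w * expR (2^-1 * ln (r (X w) (Y w) / p (X w) (Y w))))%:E <=
   (1 - c / 2)%:E * \int[P]_(w in E) (D w)%:E)%E.
Proof.
move=> Sm mXT mY mDT mX mD D0 XK mp mr dp dr pr cd GE /andP[c0 c1] cH.
have mE : measurable E.
  by move: GE; apply: smallest_sub => //; exact: sigma_algebra_measurable.
have p0 z v : 0 <= p z v by have [] := dp z.
have mpsi := measurable_half_likelihood mp mr.
have psi0 z v : 0 <= expR (2^-1 * ln (r z v / p z v)) by exact: expR_ge0.
rewrite (conditional_density_integral (psi := fun z v => expR (2^-1 * ln (r z v / p z v)))
  Sm mY mX mD D0 mp p0 mpsi psi0 cd GE).
pose q z v := expR (2^-1 * ln (r z v / p z v)) * p z v.
have q0 z v : 0 <= q z v by rewrite mulr_ge0 ?expR_ge0.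
have int_le z : `|z| <= K -> (\int[lebesgue_measure]_v (q z v)%:E <= (1 - c / 2)%:E)%E.
  move=> /cH cHz; have := half_likelihood_hellinger (dp z) (dr z) (pr z).
  have int0 : (0 <= \int[lebesgue_measure]_v (q z v)%:E)%E.
    by apply: integral_ge0 => v _; rewrite lee_fin.
  rewrite -/(q z _); have H0 := hellinger_ge0 (p z) (r z).
  move: cHz int0 H0; case: hellinger => [H| |]//; case: (\int[_]_v _)%E => [i| |]//.
  - by rewrite !lee_fin -EFinM -EFinD => ? ? ? [?]; lra.
  - by rewrite gt0_muley// lte_fin.
  - by rewrite gt0_muley// lte_fin.
have mq : measurable_fun setT (fun w => (\int[lebesgue_measure]_v (q (X w) v)%:E)%E).
  have mqq : measurable_fun setT (fun u : R * R => q u.1 u.2) by exact: measurable_funM.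
  apply: (measurable_fun_fubini_tonelli_F (m2 := lebesgue_measure)
    (fun u : T * measurableTypeR R => (q (X u.1) u.2)%:E)) => //.
  - by apply/measurable_EFinP; exact: (measurable_comp_pair_typeR mXT mqq).
  - by move=> u; rewrite lee_fin.
have mDE : measurable_fun setT (fun w => (D w)%:E) by exact/measurable_EFinP.
apply: (@le_trans _ _ (\int[P]_(w in E) ((1 - c / 2)%:E * (D w)%:E))%E).
  apply: ge0_le_integral => //.
  - move=> w _; rewrite mule_ge0 ?lee_fin//.
    by apply: integral_ge0 => v _; rewrite lee_fin; exact: q0.
  - by apply: measurable_funTS; exact: emeasurable_funM.
  - by apply: measurable_funTS; exact: emeasurable_funM.
  - by move=> w _; rewrite muleC lee_wpmul2r ?lee_fin//; exact: int_le.
rewrite ge0_integralZl//.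
- exact: measurable_funTS.
- by move=> w _; rewrite lee_fin.
- by rewrite lee_fin subr_ge0; lra.
Qed.

Lemma likelihood_ratio_cvg0 d (T : measurableType d) (R : realType)
    (P : probability T R) (N : nat) (alpha : nat -> R)
    (x y : 'I_N -> nat -> T -> R) (p r : 'I_N -> R -> R -> R) (i0 : 'I_N) (c K : R) :
  (forall t, 0 < alpha t < 1) ->
  (forall M, \forall n \near \oo, M <= \sum_(0 <= s < n) alpha s) ->
  (forall i t, measurable_fun setT (x i t)) ->
  (forall i t, measurable_fun setT (y i t)) ->
  (forall i t, measurable_fun
     (setT : set (g_sigma_algebraType (past_events x y t))) (x i t)) ->
  (forall i t w, `|x i t w| <= K) ->
  (forall i, measurable_fun setT (fun u : R * R => p i u.1 u.2)) ->
  (forall i, measurable_fun setT (fun u : R * R => r i u.1 u.2)) ->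
  (forall i z, is_density (p i z)) -> (forall i z, is_density (r i z)) ->
  (forall i z v, (p i z v == 0) = (r i z v == 0)) ->
  (forall i t, conditional_density P (past x y t) (y i t)
     (fun w v => p i (x i t w) v)) ->
  0 < c -> (forall z, `|z| <= K -> (c%:E <= hellinger (p i0 z) (r i0 z))%E) ->
  \forall w \ae P, expR (2^-1 * \sum_(s < t) alpha s *
    mean (fun i => ln (r i (x i s w) (y i s w) / p i (x i s w) (y i s w))))
    @[t --> \oo] --> 0.
Proof.
move=> a01 adiv mx my mxp xK mp mr dp dr pr cd c0 cH.
have N0 : (0 < N)%N by case: (i0) => k kN; exact: leq_ltn_trans kN.
have Nn0 : (0 : R) < N%:R by rewrite ltr0n.
pose lr i s w := ln (r i (x i s w) (y i s w) / p i (x i s w) (y i s w)).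
pose Z t w := expR (2^-1 * \sum_(s < t) alpha s * mean (fun i => lr i s w)).
(* Capping at 1 keeps the factors [1 - c' / 2] nonnegative. *)
pose c' := Num.min c 1.
have c'0 : 0 < c' by rewrite lt_min c0 ltr01.
have c'1 : c' <= 1 by rewrite ge_min lexx orbT.
have pastm t : past_events x y t `<=` measurable by exact: past_events_measurable.
have sub_past t : past x y t `<=` measurable.
  by apply: smallest_sub; [exact: sigma_algebra_measurable|exact: pastm].
have mlr d' (T' : measurableType d') (X Y : T' -> R) i :
    measurable_fun setT X -> measurable_fun setT Y ->
    measurable_fun setT (fun w => ln (r i (X w) (Y w) / p i (X w) (Y w))).
  move=> mX mY; apply: (measurableT_comp (@measurable_ln R)).
  have mXY := measurable_fun_pair mX mY.
  apply: measurable_div; first exact: (measurableT_comp (mr i) mXY).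
  exact: (measurableT_comp (mp i) mXY).
have mean_meas d' (T' : measurableType d') (h : 'I_N -> T' -> R) :
    (forall i, measurable_fun setT (h i)) ->
    measurable_fun setT (fun w => mean (h^~ w)).
  by move=> mh; apply: measurable_funM => //; exact: measurable_sum.
have mZp t : measurable_fun
    (setT : set (g_sigma_algebraType (past_events x y t))) (Z t).
  apply: (measurableT_comp (@measurable_expR R)); apply: measurable_funM => //.
  apply: measurable_sum => s; apply: measurable_funM => //.
  apply: mean_meas => i; apply: mlr.
    exact: measurable_past_x.
  exact: measurable_past_y.
have mZ t : measurable_fun setT (Z t).
  apply: (measurableT_comp (@measurable_expR R)); apply: measurable_funM => //.
  apply: measurable_sum => s; apply: measurable_funM => //.
  by apply: mean_meas => i; apply: mlr.
have Z0 t w : 0 <= Z t w by exact: expR_ge0.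
have NV : N%:R^-1 <= 1 :> R by rewrite invf_le1// ler1n.
apply: (@supermartingale_cvg0 _ _ _ P Z (past x y) (c' / 2 / N%:R) alpha) => //.
- by move=> w; rewrite /Z big_ord0 mulr0 expR0.
- by move=> t; exact: (@measurableT _ (g_sigma_algebraType (past_events x y t))).
- move=> t; exact: (@measurableI _ (g_sigma_algebraType (past_events x y t))).
- by move=> t; apply: sub_sigma_algebra2; exact: past_eventsS.
- move=> t e; have := measurable_fun_ltr (mZp t) (measurable_cst e) measurableT.
  by move=> /(_ [set true] I); rewrite setTI.
- by rewrite !divr_gt0.
- by move=> t; have /andP[/ltW] := a01 t.
- move=> t; have /andP[/ltW a0 /ltW a1] := a01 t.
  rewrite -[leRHS]mulr1; apply: ler_pM => //.
    by rewrite !divr_ge0 ?ltW.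
  rewrite -[leRHS]mulr1; apply: ler_pM => //; first by rewrite divr_ge0 ?ltW.
  lra.
move=> t E GE; have /andP[a0 a1] := a01 t.
(* Only [i0] is known to be informative; the other factors are 1, so averaging divides the gain by
   [N]. *)
pose kappa i := 1 - (if i == i0 then c' else 0) / 2.
have meank : mean kappa = 1 - c' / 2 / N%:R.
  rewrite /mean sumrB sumr_const card_ord -mulr_suml -big_mkcond big_pred1_eq.
  by field; rewrite gt_eqF.
have -> : 1 - c' / 2 / N%:R * alpha t = 1 - alpha t + alpha t * mean kappa.
  by rewrite meank; ring.
apply: (@mixture_integral_le _ _ _ P N (alpha t) kappa (Z t) (Z t.+1)
  (fun i w => expR (2^-1 * lr i t w))) => //.
- by rewrite !ltW.
- exact: sub_past GE.
- move=> i; apply: (measurableT_comp (@measurable_expR R)).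
  by apply: measurable_funM => //; apply: mlr.
- by move=> i; rewrite /kappa; case: ifP => _; lra.
- move=> w; rewrite /Z big_ord_recr/= mulrDr expRD ler_wpM2l ?expR_ge0//.
  rewrite (_ : 2^-1 * _ = alpha t * mean (fun i => 2^-1 * lr i t w)).
    by apply: expR_mean_le => //; rewrite !ltW.
  by rewrite /mean -mulr_sumr; ring.
move=> i; rewrite /kappa /lr.
apply: (@half_likelihood_integral_le _ _ _ P (past_events x y t) (x i t) (y i t)
  (Z t) (p i) (r i) _ K) => //.
- exact: cd.
- by case: ifP => _; rewrite ?(ltW c'0) ?c'1 ?lexx ?ler01.
- move=> z zK; case: eqP => [->|_]; last exact: hellinger_ge0.
  by apply: le_trans (cH z zK); rewrite lee_fin ge_min lexx.
Qed.

(** * Mean cost, measurability of the trajectories, and conclusion *)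

Lemma is_derive_mean_cost (R : realType) (N : nat) (Theta : finType)
    (J : 'I_N -> R -> Theta -> R) (th : Theta) (z : R) :
  (forall i z, derivable (fun u : R => J i u th) z 1) ->
  is_derive z (1 : R) (fun u : R => N%:R^-1 * \sum_(i < N) J i u th)
    (mean (fun i => grad (J i) z th)).
Proof.
move=> dJ; rewrite (_ : (fun u : R => _) =
    N%:R^-1 \*: (\sum_(i < N) (fun u : R => J i u th) : R -> R)).
  apply: is_deriveZ; apply: is_derive_sum => i.
  by rewrite /grad derive1E; exact: derivableP.
by apply/funext => u; rewrite /= fct_sumE.
Qed.

Lemma run_measurable_xy d (T : measurableType d) (R : realType)
    (P : probability T R) (N : nat)
    (Theta : finType) (J : 'I_N -> R -> Theta -> R)
    (f : 'I_N -> R -> R -> Theta -> R) (ths : Theta) (W : 'M[R]_N)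
    (alpha : nat -> R) (x0 : 'I_N -> R) (eps : 'I_N -> nat -> {RV P >-> R})
    (x y : 'I_N -> nat -> T -> R) (b q : 'I_N -> nat -> Theta -> T -> R) :
  (forall i th, measurable_fun setT (fun p : R * R => f i p.2 p.1 th)) ->
  (forall i th, measurable_fun setT (fun z => grad (J i) z th)) ->
  (forall i, measurable_fun setT (fun z => J i z ths)) ->
  (forall w, algorithm_run J f ths W alpha x0
    (fun i t => eps i t w) (fun i t => x i t w) (fun i t => y i t w)
    (fun i t th => b i t th w) (fun i t th => q i t th w)) ->
  (forall i t, measurable_fun setT (x i t)) /\
  (forall i t, measurable_fun setT (y i t)).
Proof.
move=> mf mgrad mJ run.
have key := run_measurable mf mgrad run.
have my t i : measurable_fun setT (y i t).
  elim/ltn_ind: t i => t IH i.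
  have [mx _] := key t (fun j s st => IH s st j).
  rewrite (_ : y i t = (fun w => J i (x i t w) ths + eps i t w)).
    apply: measurable_funD; first exact: (measurableT_comp (mJ i)).
    exact: measurable_funP.
  by apply/funext => w; rewrite (run_y (run w)).
by split=> // i t; have [mx _] := key t (fun j s _ => my s j).
Qed.

Theorem theorem4 (R : realType) (d : measure_display) (T : measurableType d)
    (P : probability T R) (N : nat) (Theta : finType) (ths : Theta)
    (J : 'I_N -> R -> Theta -> R) (f : 'I_N -> R -> R -> Theta -> R)
    (nbr : rel 'I_N) (W : 'M[R]_N) (alpha : nat -> R) (B mu L : R)
    (x0 : 'I_N -> R) (eps : 'I_N -> nat -> {RV P >-> R})
    (x y : 'I_N -> nat -> T -> R) (b q : 'I_N -> nat -> Theta -> T -> R)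
    (N_gt0 : (0 < N)%N)
    (J_derivable : forall i th z, derivable (fun u : R => J i u th) z 1)
    (f_density : forall i z th, is_density (fun v => f i v z th))
    (run : forall w : T, algorithm_run J f ths W alpha x0
       (fun i t => eps i t w) (fun i t => x i t w) (fun i t => y i t w)
       (fun i t th => b i t th w) (fun i t th => q i t th w))
    (observations : forall i t, conditional_density P (past x y t) (y i t)
       (fun w v => f i v (x i t w) ths))
    (B_gt0 : 0 < B)
    (information : bounded_information f B)
    (f_continuous : forall i v th, continuous (fun z : R => f i v z th))
    (nbr_sym : symmetric nbr)
    (nbr_connected : forall i j, connect nbr i j)
    (W_graph : weights_on_graph nbr W)
    (W_stochastic : doubly_stochastic W)
    (W_radius : 0 <= spectral_radius (W - N%:R^-1 *: const_mx 1) < 1)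
    (alpha_bounds : forall t, 0 < alpha t < 1)
    (alpha_sum : (\sum_(0 <= t <oo) (alpha t)%:E = +oo)%E)
    (alpha_sum2 : (\sum_(0 <= t <oo) (alpha t ^+ 2)%:E < +oo)%E)
    (alpha_O : exists C : R, forall t, (1 <= t)%N -> alpha t <= C / t%:R)
    (mu_gt0 : 0 < mu) (L_gt0 : 0 < L)
    (grad_monotone : forall i th z z',
       mu * `|z' - z| ^+ 2 <= (grad (J i) z' th - grad (J i) z th) * (z' - z))
    (grad_lipschitz : forall i th z z',
       `|grad (J i) z' th - grad (J i) z th| <= L * `|z' - z|)
    (identifiable : forall th, th != ths -> exists i, forall z,
       (0 < kl_div (fun v => f i v z ths) (fun v => f i v z th))%E) :
  exists2 xs : R,
    argmin (fun z => N%:R^-1 * \sum_(i < N) J i z ths) = [set xs] &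
    forall i, \forall w \ae P, x i t w @[t --> \oo] --> xs.
Proof.
have grad_regular i th : regular_gradient mu L (fun z => grad (J i) z th).
  by split=> z z'; [exact: grad_monotone|exact: grad_lipschitz].
have alpha_ge0 t : 0 <= alpha t by have /andP[/ltW] := alpha_bounds t.
have alpha0 : alpha t @[t --> \oo] --> 0.
  by have [C alphaC] := alpha_O; exact: cvg0_harmonic_bound alphaC.
have alpha_div := nneseries_pinfty_sum_ge alpha_ge0 alpha_sum.
have /andP[_ radius1] := W_radius.
have [r r01 contr] :=
  consensus_contraction nbr_sym nbr_connected W_graph W_stochastic radius1.
pose G := \sum_j \sum_th `|grad (J j) 0 th|.
have gradG j th : `|grad (J j) 0 th| <= G.
  rewrite /G (bigD1 j)//= (bigD1 th)//= -addrA lerDl.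
  by rewrite addr_ge0// sumr_ge0// => k _; rewrite sumr_ge0.
have G0 : 0 <= G by apply: sumr_ge0 => j _; exact: sumr_ge0.
have X00 : 0 <= \sum_i `|x0 i| by exact: sumr_ge0.
have [K K0 bounded] :=
  iterates_bounded W_stochastic mu_gt0 L_gt0 G0 X00 alpha_bounds alpha0.
have xK i t w : `|x i t w| <= K.
  apply: (bounded (fun t i => x i t w)
    (fun t j z => \sum_th q j t.+1 th w * grad (J j) z th)) => {i t} [i|t j|t j|t i].
  - by rewrite (run_x0 (run w)) (bigD1 i)//= lerDl sumr_ge0.
  - apply: regular_gradient_wavg => // [th|]; last exact: (run_q_sum (run w)).
    exact/ltW/(run_q_gt0 (run w)).
  - apply: ler_norm_wavg => // [th|]; last exact: (run_q_sum (run w)).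
    exact/ltW/(run_q_gt0 (run w)).
  - exact: (run_x (run w)).
have f_ge0 i v z th : 0 <= f i v z th by have [] := f_density i z th.
have lnB := ln_ratio_bounded B_gt0 f_ge0 information.
have mf i th : measurable_fun setT (fun u : R * R => f i u.2 u.1 th).
  apply: (@caratheodory_measurable _ (fun z v => f i v z th)) => [z|v].
    by have [] := f_density i z th.
  exact: f_continuous.
have mgrad i th : measurable_fun setT (fun z => grad (J i) z th).
  apply: continuous_measurable_fun.
  exact: (regular_gradient_continuous L_gt0 (grad_regular i th)).
have mJ i : measurable_fun setT (fun z => J i z ths).
  apply: continuous_measurable_fun => z; apply: differentiable_continuous.
  exact/derivable1_diffP/J_derivable.
have [mx my] := run_measurable_xy mf mgrad mJ run.
(* The run is read on the sample space carrying only the past sigma-algebra, in which earlier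
   observations are measurable by construction. *)
have mx_past i t : measurable_fun
    (setT : set (g_sigma_algebraType (past_events x y t))) (x i t).
  have [h _] := @run_measurable _ (g_sigma_algebraType (past_events x y t)) R N
    Theta J f ths W alpha x0 (fun i t w => eps i t w) x y b q mf mgrad run t
    (fun j s st => @measurable_past_y _ T R N x y t s j st).
  exact: h.
(* The law of the observations gives positivity at [ths]; the common zeros extend it to every
   parameter. *)
have f_gt0 : \forall w \ae P, forall i t th, 0 < f i (y i t w) (x i t w) th.
  have : \forall w \ae P, forall i t, 0 < f i (y i t w) (x i t w) ths.
    apply: filter_forall => i; apply/ae_foralln => t.
    apply: (likelihood_gt0_ae (p := fun z v => f i v z ths)
      (past_events_measurable mx my) (mx i t) (my i t) (mx_past i t) (mf i ths)).
      by move=> z v; exact: f_ge0.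
    exact: observations.
  apply: filterS => w h i t th; rewrite lt_def f_ge0 andbT.
  by have [-> _] := lnB i (y i t w) (x i t w) th ths; rewrite gt_eqF.
have Z0 : \forall w \ae P, forall th, th != ths ->
    expR (2^-1 * \sum_(s < t) alpha s * mean (fun i =>
      ln (f i (y i s w) (x i s w) th / f i (y i s w) (x i s w) ths)))
      @[t --> \oo] --> 0.
  apply: filter_forall => th.
  have [->|neq] := eqVneq th ths; first by apply: nearW => w /negP[].
  have [i0 kl0] := identifiable th neq.
  have zeros i z v : (f i v z ths == 0) = (f i v z th == 0).
    by have [] := lnB i v z ths th.
  have [c c0 cH] : exists2 c : R, 0 < c & forall z, `|z| <= K ->
      (c%:E <= hellinger (fun v => f i0 v z ths) (fun v => f i0 v z th))%E.
    apply: hellinger_lower_bound => [z|z|v|v|z].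
    - by have [] := f_density i0 z ths.
    - by have [] := f_density i0 z th.
    - exact: f_continuous.
    - exact: f_continuous.
    - by apply: hellinger_gt0 => //; exact: zeros.
  have := likelihood_ratio_cvg0 (p := fun i z v => f i v z ths)
    (r := fun i z v => f i v z th) alpha_bounds alpha_div mx my mx_past xK
    (fun i => mf i ths) (fun i => mf i th) (fun i z => f_density i z ths)
    (fun i z => f_density i z th) zeros observations c0 cH.
  by apply: filterS.
pose phi z := mean (fun i => grad (J i) z ths).
have rphi : regular_gradient mu L phi.
  have -> : phi = (fun z => \sum_(j < N) N%:R^-1 * grad (J j) z ths).
    by apply/funext => z; rewrite /phi /mean mulr_sumr.
  apply: regular_gradient_wavg => //.
  by rewrite sumr_const card_ord -[LHS]mulr_natl divff// pnatr_eq0 -lt0n.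
have [xs phi0] := regular_gradient_zero mu_gt0 L_gt0 rphi.
exists xs.
  apply: (argmin_regular_gradient mu_gt0 rphi _ phi0) => z.
  by apply: is_derive_mean_cost => i u; exact: J_derivable.
(* On the intersection of two events of full measure, the rest is deterministic, one sample point at
   a time. *)
move=> i; apply: filterS2 f_gt0 Z0 => w fw Zw.
have runw := run w.
apply: (@descent_cvg _ _ W _ ths r mu L K xs alpha (fun j th z => grad (J j) z th)
  (fun t j => x j t w) (fun t j th => q j t.+1 th w)) => //.
- by move=> t j th; exact/ltW/(run_q_gt0 runw).
- by move=> t j; exact: (run_q_sum runw).
(* The decision update at time [t] uses the belief at [t.+1], hence the shift. *)
- move=> j th neq; rewrite (@cvg_shiftS _ (fun t => q j t th w)).
  apply: (@belief_cvg0 _ _ _ _ _ ths th W alpha _ _ _ _ _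
    (fun i t th => q i t th w) r B N_gt0 W_stochastic r01 contr alpha0 runw) => //.
  + by move=> k t; have [_] := lnB k (y k t w) (x k t w) th ths.
  + exact: Zw.
- by move=> t j; exact: (run_x runw).
Qed.
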